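(* Let $X$ be a Cantor set and $f\colon X\to X$ a continuous map. Then $(X,f)$ can be embedded in the real line with vanishing derivative if and only if all finite orbits of $(X,f)$ are attractors.
   Context: A Cantor set is a (nonempty) zero-dimensional compact metric space without isolated points, where zero-dimensional means having a base of clopen sets. A dynamical system $(X,f)$ is a space $X$ with a continuous map $f\colon X\to X$. $(X,f)$ can be embedded in the real line with vanishing derivative when there exist a differentiable function $g\colon\mathbb{R}\to\mathbb{R}$, a closed set $Z\subset\mathbb{R}$ invariant for $g$ (that is, $g(Z)\subset Z$), and a homeomorphism $\psi\colon X\to Z$ such that $g|_Z=\psi\circ f\circ\psi^{-1}$ and $g'(z)=0$ for all $z\in Z$. A finite orbit is a periodic orbit, i.e. a set $p=\{x,f(x),\dots,f^{k-1}(x)\}$ with $k\ge 1$ and $f^k(x)=x$. A subset $u\subset X$ is stable when $f(u)\subset u$. A finite orbit $p$ is attracting (an attractor) when there exists a stable clopen set $u\subset X$ containing $p$ such that $\bigcap_{n\ge 0}f^n(u)=p$. *)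

(* Defs.v *)
From HB Require Import structures.
From mathcomp Require Import all_boot all_order all_algebra.
From mathcomp Require Import all_classical all_reals all_analysis.

Set Implicit Arguments.
Unset Strict Implicit.
Unset Printing Implicit Defensive.

Import Order.TTheory GRing.Theory Num.Theory.
Import numFieldNormedType.Exports.

Local Open Scope classical_set_scope.
Local Open Scope ring_scope.

(* The library's [zero_dimensional] (points are separated by clopen sets) is a
   weaker property of general metric spaces, hence the explicit clopen base. *)
Definition clopen_base (X : topologicalType) : Prop :=
  exists2 B : set_system X, basis B & forall U : set X, B U -> clopen U.

Definition cantor_set (R : realType) (X : metricType R) : Prop :=
  [/\ [set: X] !=set0,
      compact [set: X],
      clopen_base X &
      isolated [set: X] = set0].

(* [Z] used as a type is the subtype [set_type Z] with its induced topology, so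
   [psi] and [psiinv] are mutually inverse continuous maps between [X] and the
   subspace [Z] of the real line.  The scope annotation selects [derive1], the
   analytic derivative, rather than the formal derivative of a polynomial. *)
Definition embeddable_with_vanishing_derivative
    (R : realType) (X : metricType R) (f : X -> X) : Prop :=
  exists (g : R -> R) (Z : set R) (psi : X -> Z) (psiinv : Z -> X),
    [/\ forall x : R, derivable g x 1,
        closed Z /\ g @` Z `<=` Z,
        [/\ continuous psi, continuous psiinv,
            cancel psi psiinv & cancel psiinv psi],
        forall z : Z, g (\val z) = \val (psi (f (psiinv z))) &
        forall z : R, Z z -> (g^`() z)%classic = 0].

Definition finite_orbit (X : Type) (f : X -> X) (p : set X) : Prop :=
  exists (x : X) (k : nat),
    [/\ (0 < k)%N, iter k f x = x & p = [set iter i f x | i in `I_k]].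

Definition stable (X : Type) (f : X -> X) (u : set X) : Prop :=
  f @` u `<=` u.

Definition attracting (X : topologicalType) (f : X -> X) (p : set X) : Prop :=
  exists u : set X,
    [/\ stable f u, clopen u, p `<=` u &
        \bigcap_(n in [set: nat]) (iter n f @` u) = p].

(* Main.v *)
(* Call an injective continuous psi : X -> R flat when
   |psi (f y) - psi (f x)| = o(|psi y - psi x|) as y -> x, at every x.  The
   system embeds with vanishing derivative iff a flat psi exists: interpolating
   by a smoothstep on the gaps of the image extends the induced map to a
   differentiable map of the line.  A flat psi contracts distances near a
   finite orbit, so finite orbits are attracting.

   Conversely, flatness of psi only depends on nested clopen partitions P_n with
   rank functions h_n such that, at each x and for large n, the class P_n(x) is
   mapped either into a class of P_(n+1) or into a class of P_n of smaller rank: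
   one takes psi = sum_n r_n pi_(n+1), with pi_n labelling P_n and weights r_n
   decreasing very fast in n and, within level n, as the rank decreases.  Such
   partitions come from disjoint clopen markers B_n that every orbit hits, except
   those falling into shrinking neighbourhoods of finitely many attracting
   periodic points: P_n records the itinerary up to the hitting time of B_n or of
   these neighbourhoods, and the rank is the hitting time.  As the B_n are
   disjoint, each point is exceptional for at most one n. *)
Require Import Defs.
From mathcomp Require Import all_boot all_order all_algebra.
From mathcomp Require Import all_classical all_reals all_analysis.
From mathcomp Require Import zify ring lra.

Set Implicit Arguments.
Unset Strict Implicit.
Unset Printing Implicit Defensive.

Import Order.TTheory GRing.Theory Num.Theory.
Import numFieldNormedType.Exports.

Local Open Scope classical_set_scope.
Local Open Scope ring_scope.

(** * Locally constant maps and clopen partitions of compact spaces *)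

Definition locally_constant (X : topologicalType) (T : Type) (q : X -> T) :=
  forall x, \forall y \near x, q y = q x.

Section LocallyConstant.
Variable X : topologicalType.

Lemma lc_comp (S T : Type) (g : S -> T) (q : X -> S) :
  locally_constant q -> locally_constant (fun x => g (q x)).
Proof. by move=> qlc x; apply: filterS (qlc x) => y ->. Qed.

Lemma lc_pair (S T : Type) (q : X -> S) (r : X -> T) :
  locally_constant q -> locally_constant r ->
  locally_constant (fun x => (q x, r x)).
Proof. by move=> qlc rlc x; apply: filterS2 (qlc x) (rlc x) => y -> ->. Qed.

Lemma lc_comp_continuous (T : Type) (f : X -> X) (q : X -> T) :
  continuous f -> locally_constant q -> locally_constant (fun x => q (f x)).
Proof. by move=> fc qlc x; apply: (fc x _ (qlc (f x))). Qed.

Lemma lc_iter (T : Type) (f : X -> X) (q : X -> T) (n : nat) :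
  continuous f -> locally_constant q ->
  locally_constant (fun x => q (iter n f x)).
Proof.
move=> fc; elim: n q => [|n IHn] q qlc //=.
exact: (IHn (fun x => q (f x)) (lc_comp_continuous fc qlc)).
Qed.

Lemma lc_cst (T : Type) (c : T) : locally_constant (fun _ : X => c).
Proof. by move=> x; apply: nearW. Qed.

Lemma lc_map (I : eqType) (T : Type) (s : seq I) (q : I -> X -> T) :
  (forall i, i \in s -> locally_constant (q i)) ->
  locally_constant (fun x => [seq q i x | i <- s]).
Proof.
elim: s => [|i s IHs] qlc; first exact: lc_cst.
have ilc := qlc i (mem_head _ _).
have slc : locally_constant (fun x => [seq q i x | i <- s]).
  by apply: IHs => j js; apply: qlc; rewrite inE js orbT.
exact: (lc_comp (fun p => p.1 :: p.2) (lc_pair ilc slc)).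
Qed.

(** Since a set is a map to [Prop], clopen sets can be handled as locally constant maps and combined
    through [lc_comp] and [lc_pair]. *)
Lemma clopen_lc (A : set X) : clopen A -> locally_constant A.
Proof.
move=> [Ao Ac] x; have [Ax|nAx] := pselect (A x).
  apply: filterS (open_nbhs_nbhs (conj Ao Ax)) => y Ay.
  by apply/propext; split.
apply: filterS (open_nbhs_nbhs (conj (closed_openC Ac) nAx)) => y nAy.
by apply/propext; split.
Qed.

Lemma lc_clopen (A : set X) : locally_constant A -> clopen A.
Proof.
move=> Alc; split.
  by rewrite openE => x Ax; apply: filterS (Alc x) => y ->.
rewrite -[A]setCK; apply: open_closedC.
by rewrite openE => x nAx; apply: filterS (Alc x) => y e; rewrite /setC /= e.
Qed.

Hypothesis cptX : compact [set: X].

Lemma compact_cluster_seq (z : nat -> X) :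
  exists y : X, forall U, nbhs y U -> forall N, exists2 n, (N <= n)%N & U (z n).
Proof.
have [y [_ ycl]] := @cptX (z @ \oo) _ filterT.
exists y => U yU N.
have tailF : (z @ \oo) (z @` [set n | (N <= n)%N]).
  by exists N => // n /= Nn; exists n.
by have [_ [[n Nn <-] Uzn]] := ycl _ _ tailF yU; exists n.
Qed.

(** Points where [q] takes larger and larger values would cluster at a point near which [q] is
    constant. *)
Lemma lc_bounded (q : X -> nat) :
  locally_constant q -> exists M, forall x, (q x < M)%N.
Proof.
move=> qlc; apply: contrapT => /forallNP unb.
have /choice[z zP] : forall n, exists x, (n <= q x)%N.
  move=> n; have /existsNP[x /negP] := unb n.
  by rewrite -leqNgt => nx; exists x.
have [y yP] := compact_cluster_seq z.
have [n yn qe] := yP _ (qlc y) (q y).+1.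
by have := zP n; rewrite /= in qe; rewrite qe leqNgt yn.
Qed.

(** Compactness gives a finite clopen cover refining [U]; labelling a point by the first member that
    contains it turns the cover into a partition. *)
Lemma lc_partition (U : X -> set X) :
  clopen_base X -> (forall x, nbhs x (U x)) ->
  exists (D : seq X) (q : X -> nat), locally_constant q /\
    forall x, exists2 z, z \in D & forall y, q y = q x -> U z y.
Proof.
move=> [Bs [Bopen Bnbhs] Bcl] xU.
have /choice[V VP] : forall x, exists V, [/\ clopen V, V x & V `<=` U x].
  move=> x; have [V [BV Vx] VU] := Bnbhs x _ (xU x).
  by exists V; split => //; exact: Bcl.
(* Finite lists directed by inclusion: the near-covering form of compactness along this filter
   yields a finite subcover. *)
pose F := filter_from [set: seq X] (fun s => [set s' : seq X | {subset s <= s'}]).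
have FF : Filter F.
  apply: filter_from_filter; first by exists [::].
  move=> s t _ _; exists (s ++ t) => // u stu.
  by split=> z zs; apply: stu; rewrite mem_cat zs ?orbT.
have [x _|s _ sV] := (compact_near_coveringP _).1 cptX _ F
    (fun s y => exists2 t, t \in s & V t y) FF.
  exists (V x, [set s : seq X | x \in s]) => /=; last by case=> y s [Vy xs]; exists x.
  split; first by have [[Vo _] Vx _] := VP x; exact: open_nbhs_nbhs.
  by exists [:: x] => // s; apply; rewrite mem_head.
have {}sV x : exists2 t, t \in s & V t x by apply: sV.
pose q x := find id [seq `[< V t x >] | t <- s].
exists s, q; split.
  apply: lc_comp; apply: lc_map => t _.
  by have [/clopen_lc + _ _] := VP t; apply: lc_comp.
move=> x; have [t tD Vtx] := sV x.
have qs y : q y = find (fun t => `[< V t y >]) s.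
  by rewrite /q find_map; apply: eq_find.
have hasx : has (fun t => `[< V t x >]) s.
  by apply/hasP; exists t => //; apply/asboolP.
exists (nth x s (q x)).
  by apply: mem_nth; rewrite qs -has_find.
move=> y qyx; have [_ _] := VP (nth x s (q x)); apply.
have := hasx; rewrite has_find -qs -qyx qs -has_find => /(nth_find x).
by rewrite -qs qyx => /asboolP.
Qed.

(** The first hitting time of [x] is decided by whether its first [tau x + 1] iterates lie in [A],
    which is finitely many locally constant conditions. *)
Lemma hitting_time (f : X -> X) (A : set X) :
  continuous f -> locally_constant A -> (forall x, exists j, A (iter j f x)) ->
  exists tau : X -> nat, [/\ locally_constant tau,
    forall x, A (iter (tau x) f x) &
    forall x j, A (iter j f x) -> (tau x <= j)%N].
Proof.
move=> fc Alc hit.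
have /choice[tau tauP] : forall x, exists t,
    A (iter t f x) /\ forall j, A (iter j f x) -> (t <= j)%N.
  move=> x; have [j Aj] := hit x.
  have ex : exists j, `[< A (iter j f x) >] by exists j; apply/asboolP.
  exists (ex_minn ex); case: ex_minnP => m /asboolP Am mmin; split => // i Ai.
  by apply: mmin; apply/asboolP.
exists tau; split => [x|x|x]; [|by case: (tauP x)..].
have nearj : \forall y \near x,
    [seq A (iter j f y) | j <- iota 0 (tau x).+1]
    = [seq A (iter j f x) | j <- iota 0 (tau x).+1].
  by apply: lc_map => j _; exact: lc_iter.
apply: filterS nearj => y e.
have {}e j : (j <= tau x)%N -> A (iter j f y) = A (iter j f x).
  move=> jt; have := congr1 (fun s => nth True s j) e.
  by rewrite !(nth_map 0%N) ?size_iota ?nth_iota ?ltnS.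
have [Ax xmin] := tauP x; have [Ay ymin] := tauP y.
have yx : (tau y <= tau x)%N by apply: ymin; rewrite e.
by apply/eqP; rewrite eqn_leq yx xmin // -e.
Qed.

End LocallyConstant.

(** * Nested clopen partitions that take over the role of the metric *)

Definition clopen_scale (X : topologicalType) (q : nat -> X -> nat) :=
  [/\ forall n, locally_constant (q n),
      forall m n x y, (m <= n)%N -> q n x = q n y -> q m x = q m y &
      forall x U, nbhs x U -> exists n, forall y, q n y = q n x -> U y].

(** The [n]-th classes lie in balls of radius [1 / (n + 1)]; coding all labels up to [n] into one
    number forces nesting. *)
Lemma exists_clopen_scale (R : realType) (X : metricType R) :
  compact [set: X] -> clopen_base X -> exists q, clopen_scale (X := X) q.
Proof.
move=> cptX bX.
have /choice[q qP] : forall n : nat, exists q : X -> nat, locally_constant q /\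
    forall x, exists z, forall y, q y = q x -> ball z n.+1%:R^-1 y.
  move=> n; have [|D [q [qlc qball]]] :=
    lc_partition (U := fun x => ball x n.+1%:R^-1) cptX bX.
    by move=> x; apply: nbhsx_ballx; rewrite invr_gt0.
  by exists q; split=> // x; have [z _ zP] := qball x; exists z.
exists (fun n x => pickle [seq q i x | i <- iota 0 n.+1]); split.
- by move=> n; apply/lc_comp/lc_map => i _; case: (qP i).
- move=> m n x y mn /(pcan_inj pickleK) e; congr pickle.
  have := congr1 (take m.+1) e.
  by rewrite -!map_take take_iota (minn_idPl _).
- move=> x U /nbhs_ballP[_/posnumP[e] eU].
  have [n ne] : exists n : nat, 2 / n.+1%:R < e%:num.
    exists (Num.truncn (2 / e%:num)); rewrite ltr_pdivrMr//.
    by rewrite mulrC -ltr_pdivrMr// truncnS_gt.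
  exists n => y /(pcan_inj pickleK) e'; apply: eU.
  have {}e' : q n y = q n x.
    have := congr1 (nth 0%N ^~ n) e'.
    by rewrite !(nth_map 0%N) ?size_iota ?ltnS// nth_iota.
  have [_ /(_ x)[z zq]] := qP n.
  apply: le_ball (ltW ne) _ _; rewrite [2](_ : _ = 1 + 1) // mulrDl.
  rewrite mul1r; apply: ball_triangle (zq _ e').
  exact/ball_sym/zq.
Qed.

(** * Uniform choices over finite families, and finite orbits as lists *)

Lemma near_all_seq (T : eqType) (U : Type) (F : set_system U) (FF : Filter F)
    (s : seq T) (P : T -> U -> Prop) :
  (forall t, t \in s -> \forall y \near F, P t y) ->
  \forall y \near F, forall t, t \in s -> P t y.
Proof.
elim: s => [|t s IHs] sP; first exact: nearW.
have tP := sP t (mem_head _ _).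
have {}IHs : \forall y \near F, forall t, t \in s -> P t y.
  by apply: IHs => t' t's; apply: sP; rewrite inE t's orbT.
by apply: filterS2 tP IHs => y Pty Psy t'; rewrite inE => /predU1P[->//|/Psy].
Qed.

Lemma near_all_ltn (U : Type) (F : set_system U) (FF : Filter F)
    (n : nat) (P : nat -> U -> Prop) :
  (forall j, (j < n)%N -> \forall y \near F, P j y) ->
  \forall y \near F, forall j, (j < n)%N -> P j y.
Proof.
move=> nP; have : \forall y \near F, forall j, j \in iota 0 n -> P j y.
  by apply: near_all_seq => j; rewrite mem_iota; exact: nP.
by apply: filterS => y Py j jn; apply: Py; rewrite mem_iota.
Qed.

Lemma uniform_nat_seq (T : eqType) (s : seq T) (P : T -> nat -> Prop) :
  (forall t n m, (n <= m)%N -> P t n -> P t m) ->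
  (forall t, t \in s -> exists n, P t n) ->
  exists n, forall t, t \in s -> P t n.
Proof.
move=> Pmono sP; have /filter_ex[n] : \forall n \near \oo, forall t, t \in s -> P t n.
  apply: near_all_seq => t /sP[n Ptn].
  by exists n => // m /= nm; exact: Pmono nm Ptn.
by exists n.
Qed.

Lemma uniform_pos_seq (R : realFieldType) (T : eqType) (s : seq T)
    (P : T -> R -> Prop) :
  (forall t d e, d <= e -> P t e -> P t d) ->
  (forall t, t \in s -> exists2 d, 0 < d & P t d) ->
  exists2 d, 0 < d & forall t, t \in s -> P t d.
Proof.
move=> Pmono; elim: s => [|t s IHs] sP; first by exists 1.
have [d d0 dP] := sP t (mem_head _ _).
have [|e e0 eP] := IHs; first by move=> t' t's; apply: sP; rewrite inE t's orbT.
exists (Num.min d e); first by rewrite lt_min d0.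
move=> t'; rewrite inE => /predU1P[->|/eP].
  by apply: Pmono dP; rewrite ge_min lexx.
by apply: Pmono; rewrite ge_min lexx orbT.
Qed.

Lemma finite_orbit_seq (X : choiceType) (f : X -> X) (p : set X) :
  finite_orbit f p ->
  exists (k : nat) (s : seq X), [/\ (0 < k)%N, p = [set t | t \in s],
    forall t, t \in s -> f t \in s & forall t, t \in s -> iter k f t = t].
Proof.
move=> [x [k [k0 xk ->]]]; exists k, [seq iter i f x | i <- iota 0 k]; split=> //.
- apply/seteqP; split=> [_ [i ik <-]|t /= /mapP[i]].
    by apply/mapP; exists i => //; rewrite mem_iota.
  by rewrite mem_iota => ik ->; exists i.
- move=> _ /mapP[i + ->]; rewrite mem_iota add0n => /= ik.
  apply/mapP; have [ik'|ik'] := eqVneq i.+1 k.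
    by exists 0%N; rewrite ?mem_iota// -iterS ik' xk.
  by exists i.+1 => //; rewrite mem_iota add0n ltn_neqAle ik'.
- by move=> _ /mapP[i _ ->]; rewrite -iterD addnC iterD xk.
Qed.

(** * Flat embeddings make finite orbits attracting *)

Definition flat_embedding (R : realType) (X : topologicalType) (f : X -> X)
    (psi : X -> R) : Prop :=
  [/\ continuous psi, injective psi & forall (x : X) (e : R), 0 < e ->
    \forall y \near x, `|psi (f y) - psi (f x)| <= e * `|psi y - psi x|].

Section FlatAttracting.
Variables (R : realType) (X : metricType R).
Hypothesis cptX : compact [set: X].

(** This is continuity of the inverse of [psi]. Points outside [U] with images tending to [psi x]
    would cluster at a point with the same image as [x], hence at [x] itself. *)
Lemma compact_embedding_nbhs (psi : X -> R) (x : X) (U : set X) :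
  continuous psi -> injective psi -> nbhs x U ->
  exists2 d, 0 < d & forall y, `|psi y - psi x| < d -> U y.
Proof.
move=> psic psiI xU; apply: contrapT => noU.
have /choice[z zP] : forall n : nat, exists y,
    `|psi y - psi x| < n.+1%:R^-1 /\ ~ U y.
  move=> n; apply: contrapT => /forallNP nz; apply: noU.
  exists n.+1%:R^-1; first by rewrite invr_gt0.
  by move=> y yx; apply: contrapT => nUy; apply: (nz y).
have [y yP] := compact_cluster_seq cptX z.
suff yx : y = x.
  by have [n _] := yP U (eq_ind_r (nbhs^~ U) xU yx) 0%N; have [] := zP n.
apply: psiI; apply/eqP; rewrite -subr_eq0 -normr_le0.
apply/ler_addgt0Pl => e e0; rewrite addr0.
have e2 : 0 < e / 2 by rewrite divr_gt0.
have [N Ne] : exists N : nat, 1 / (e / 2) < N.+1%:R.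
  by exists (Num.truncn (1 / (e / 2))); rewrite truncnS_gt.
have ynear : \forall w \near y, `|psi y - psi w| < e / 2.
  exact: (psic y _ (nbhsx_ballx (psi y) _ e2)).
have [n Nn yzn] := yP _ ynear N.
have [znx _] := zP n.
have nN : n.+1%:R^-1 <= (e / 2).
  rewrite invf_ple ?posrE// -div1r (le_trans (ltW Ne))//.
  by rewrite ler_nat.
rewrite (splitr e) -(subrKA (psi (z n))).
by rewrite (le_trans (ler_normD _ _))// lerD ?ltW// (lt_le_trans znx).
Qed.

(** On a neighbourhood [W] of the orbit, [f] halves the distance to the orbit measured by [psi]. A
    point that stays in [W] long enough gets so close that it never leaves; such points form the
    stable clopen set. *)
Lemma flat_embedding_attracting (f : X -> X) (psi : X -> R) (p : set X) :
  clopen_base X -> continuous f -> flat_embedding f psi ->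
  finite_orbit f p -> attracting f p.
Proof.
move=> bX fc [psic psiI psif] /finite_orbit_seq[k [s [k0 -> fs sk]]].
have [q [qlc qn qb]] := exists_clopen_scale cptX bX.
(* The second clause makes [t] a nearest orbit point, so that contraction towards [f t] controls the
   distance to the whole orbit. *)
pose good t y := `|psi (f y) - psi (f t)| <= 2^-1 * `|psi y - psi t| /\
  forall t', t' \in s -> `|psi y - psi t| <= `|psi y - psi t'|.
have sgood t : t \in s -> \forall y \near t, good t y.
  move=> ts; apply: filterI; first by apply: psif; rewrite invr_gt0.
  apply: near_all_seq => t' t's.
  have [->|tt'] := eqVneq t' t; first exact: nearW.
  have d0 : 0 < `|psi t - psi t'| / 2.
    rewrite divr_gt0// normr_gt0 subr_eq0.
    by apply/eqP => /psiI /esym/eqP; exact/negP.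
  have : \forall y \near t, `|psi t - psi y| < `|psi t - psi t'| / 2.
    exact: (psic t _ (nbhsx_ballx (psi t) _ d0)).
  apply: filterS => y yt; have := ler_distD (psi y) (psi t) (psi t').
  rewrite (distrC (psi y) (psi t)); lra.
have [n nP] : exists n, forall t, t \in s -> forall y, q n y = q n t -> good t y.
  apply: uniform_nat_seq => [t n m nm tn y /(qn _ _ _ _ nm)|t /sgood /qb//].
  exact: tn.
pose W y := exists2 t, t \in s & q n y = q n t.
have Wlc : locally_constant W.
  exact: (lc_comp (fun i => exists2 t, t \in s & i = q n t) (qlc n)).
have sW t : t \in s -> W t by exists t.
pose E c y := exists2 t, t \in s & `|psi y - psi t| <= c.
have Ehalf c y : W y -> E c y -> E (c / 2) (f y).
  move=> [t ts /(nP _ ts)[yt ymin]] [t' t's yt'].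
  exists (f t); first exact: fs.
  by have := ymin _ t's; lra.
have [d d0 dW] : exists2 d, 0 < d & forall t, t \in s ->
    forall y, `|psi y - psi t| < d -> W y.
  apply: uniform_pos_seq => [t d e de eP y yd|t ts].
    by apply: eP; exact: lt_le_trans yd de.
  apply: compact_embedding_nbhs => //.
  by apply: filterS (qlc n t) => y yt; exists t.
have [C C0 CP] : exists2 C, 0 < C & forall x y, `|psi x - psi y| <= C.
  have : compact (range psi).
    by apply: continuous_compact => //; exact: continuous_subspaceT.
  move=> /compact_bounded[M [_ MP]].
  have psiM x : `|psi x| <= `|M| + 1.
    by apply: MP; [rewrite ltr_pwDr// ler_norm|exists x].
  exists ((`|M| + 1) * 2); first by rewrite mulr_gt0// ltr_wpDl.
  move=> x y; rewrite (le_trans (ler_normB _ _))// mulr_natr mulr2n.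
  by rewrite lerD.
(* After [m] halvings the diameter bound [C] drops below [d], the distance that guarantees
   membership in [W]. *)
have [m mP] : exists m, C / 2 ^+ m < d.
  exists (Num.truncn (C / d)); rewrite ltr_pdivrMr ?exprn_gt0//.
  rewrite mulrC -ltr_pdivrMr//; apply: lt_le_trans (truncnS_gt _) _.
  by rewrite -natrX ler_nat ltn_expl.
pose u y := forall j, (j < m.+1)%N -> W (iter j f y).
have Eiter j y : (forall i, (i <= j)%N -> W (iter i f y)) ->
    E (C / 2 ^+ j) (iter j f y).
  elim: j => [|j IHj] Wi.
    by have [t ts _] := Wi 0%N isT; exists t; rewrite // expr0 divr1.
  have := Ehalf _ _ (Wi j (leqnSn j)) (IHj (fun i ij => Wi i (leqW ij))).
  by rewrite exprSr invfM mulrA.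
have EW j y : (m <= j)%N -> E (C / 2 ^+ j) y -> W y.
  move=> mj [t ts yt]; apply: (dW _ ts); apply: le_lt_trans yt _.
  apply: le_lt_trans mP; rewrite ler_pM2l// lef_pV2 ?posrE ?exprn_gt0//.
  by rewrite ler_weXn2l// ler1n.
have fu y : u y -> u (f y).
  move=> uy j; rewrite ltnS leq_eqVlt -iterSr => /predU1P[->|jm]; last exact: uy.
  apply: (EW m.+1) => //; rewrite iterS exprSr invfM mulrA; apply: Ehalf.
    exact: uy.
  exact: Eiter.
have siter j t : t \in s -> iter j f t \in s.
  by move=> ts; elim: j => //= j /fs.
exists u; split.
- by move=> _ [y uy <-]; exact: fu.
- apply: lc_clopen => y.
  have : \forall z \near y, forall j, (j < m.+1)%N ->
      W (iter j f z) = W (iter j f y).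
    by apply: near_all_ltn => j _; exact: lc_iter.
  apply: filterS => z zy; apply/propext.
  by split=> uz j jm; [rewrite -zy|rewrite zy]; auto.
- by move=> t /= ts j _; exact/sW/siter.
- apply/seteqP; split=> [y yu|t /= ts n' _].
    apply: contrapT => ys.
    have [e e0 eP] : exists2 e, 0 < e & forall t, t \in s ->
        `|psi y - psi t| <= e -> False.
      apply: uniform_pos_seq => [t d' e de eP yd|t ts].
        by apply: eP; exact: le_trans yd de.
      exists (`|psi y - psi t| / 2).
        rewrite divr_gt0// normr_gt0 subr_eq0.
        by apply/eqP => /psiI yt; apply: ys; rewrite /= yt.
      have : 0 < `|psi y - psi t|.
        rewrite normr_gt0 subr_eq0.
        by apply/eqP => /psiI yt; apply: ys; rewrite /= yt.
      lra.
    have [j jP] : exists j, C / 2 ^+ j < e.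
      exists (Num.truncn (C / e)); rewrite ltr_pdivrMr ?exprn_gt0//.
      rewrite mulrC -ltr_pdivrMr//; apply: lt_le_trans (truncnS_gt _) _.
      by rewrite -natrX ler_nat ltn_expl.
    have [z uz zy] := yu j I.
    have [|t ts] := @Eiter j z; last first.
      by rewrite zy => yt; apply: (eP t ts); exact: le_trans yt (ltW jP).
    have fuz i : u (iter i f z) by elim: i => //= i /fu.
    by move=> i _; exact: (fuz i 0%N).
  (* Since [n' * k] is a multiple of the period, [n'] further steps lead from this point to [t]. *)
  exists (iter (n' * k - n') f t).
    by move=> j _; exact/sW/siter/siter.
  rewrite -iterD subnKC ?leq_pmulr//.
  by elim: (n') => // i IHi; rewrite mulSn iterD IHi sk.
Qed.

End FlatAttracting.

(** * Differentiable extension of a flat function from a closed set to the line *)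

Section FlatExtension.
Variable R : realType.
Implicit Types (Z : set R) (phi g : R -> R).

Definition flat_within Z phi z := forall e, 0 < e ->
  exists2 d, 0 < d &
    forall w, Z w -> `|w - z| < d -> `|phi w - phi z| <= e * `|w - z|.

Lemma flat_within_is_derive g z :
  flat_within [set: R] g z -> is_derive z (1 : R) g 0.
Proof.
move=> gz.
have gcvg : (fun h => h^-1 *: ((g \o shift z) (h *: 1) - g z)) @ 0^' --> (0 : R).
  apply/cvgrPdist_le => e e0; have [d d0 dP] := gz _ e0.
  near=> h; have h0 : h != 0 by near: h; exact: nbhs_dnbhs_neq.
  have hd : `|h| < d by near: h; exact: dnbhs0_lt.
  rewrite sub0r normrN /= [h *: 1]mulr1 normrM normfV ler_pdivrMl ?normr_gt0//.
  by have := dP (h + z) I; rewrite addrK mulrC; apply.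
by apply: DeriveDef; [apply/cvg_ex; exists 0|exact: cvg_lim gcvg].
Unshelve. all: by end_near. Qed.

Lemma closed_nearest_left Z x : closed Z -> (exists2 w, Z w & w <= x) ->
  exists a, [/\ Z a, a <= x & forall w, Z w -> w <= x -> w <= a].
Proof.
move=> Zc [w0 Zw0 w0x]; pose A := Z `&` [set w | w <= x].
have A0 : A !=set0 by exists w0.
have Aub : has_ubound A by exists x => w [].
have [Za ax] : A (sup A).
  suff Ac : closed A by exact: (Ac _ (closure_sup A0 Aub)).
  by apply: closedI => //; exact: closed_le.
by exists (sup A); split => // w Zw wx; apply: ub_le_sup.
Qed.

(** The right end comes from [closed_nearest_left] applied to the reflection of [Z]. For [x] in [Z]
    the interval may degenerate to a point. *)
Lemma closed_gap Z x : closed Z -> (exists2 w, Z w & w <= x) ->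
  (exists2 w, Z w & x <= w) ->
  exists ab : R * R, [/\ Z ab.1, Z ab.2, ab.1 <= x <= ab.2 &
    forall w, Z w -> w <= ab.1 \/ ab.2 <= w].
Proof.
move=> Zc Zl [w Zw xw].
have [a [Za ax amax]] := closed_nearest_left Zc Zl.
have [||b [Zb bx bmax]] := @closed_nearest_left [set w | Z (- w)] (- x).
- by apply: closed_comp => // y _; exact: continuousN.
- by exists (- w); rewrite /= ?opprK// lerN2.
exists (a, - b) => /=; split => //; first by rewrite ax lerNr.
move=> v Zv; have [vx|/ltW xv] := leP v x; [by left; exact: amax|right].
by rewrite lerNl; apply: bmax; rewrite /= ?opprK// lerN2.
Qed.

Let smoothstep (t : R) := t ^+ 2 * (3 - 2 * t).

(** Here [t * L] is the distance to the near end of a gap of length [L]: the weight of the far end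
    compensates for its distance, to first and to second order. *)
Let smoothstep_bounds t L : 0 <= t <= 1 -> 0 <= L ->
  [/\ 0 <= smoothstep t <= 1, smoothstep t * L <= 3 * (t * L) &
      smoothstep t * L ^+ 2 <= 3 * (t * L) ^+ 2].
Proof.
move=> /andP[t0 t1] L0; rewrite /smoothstep; split.
- apply/andP; split; first by apply: mulr_ge0; [exact: sqr_ge0|lra].
  rewrite -subr_ge0 [X in 0 <= X](_ : _ = (1 - t) ^+ 2 * (1 + 2 * t)); last ring.
  by apply: mulr_ge0; [exact: sqr_ge0|lra].
- have tL : 0 <= t * L by exact: mulr_ge0.
  have : 0 <= (t * L) * (3 - t * (3 - 2 * t)).
    by apply: mulr_ge0 => //; nra.
  by nra.
- have tL : 0 <= (t * L) ^+ 2 by exact: sqr_ge0.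
  have : 0 <= (t * L) ^+ 2 * (2 * t) by apply: mulr_ge0 => //; lra.
  by nra.
Qed.

(* [P] and [Q] are the increments of [phi] to the near and far ends of a gap of
   length [L], [al] and [d] the distances of the near end to the base point and to
   the interpolated point, and [s] the weight of the far end. *)
Let interpolation_bound (e C al d L s P Q : R) :
  0 <= e -> 0 <= C -> 0 <= al -> 0 <= d -> 0 <= L -> 0 <= s <= 1 ->
  s * L <= 3 * d -> s * L ^+ 2 <= 3 * d ^+ 2 ->
  `|P| <= e * al + C * al ^+ 2 ->
  `|Q| <= e * (al + L) + C * (al + L) ^+ 2 ->
  `|(1 - s) * P + s * Q| <= 3 * e * (al + d) + 6 * C * (al + d) ^+ 2.
Proof.
move=> e0 C0 al0 d0 L0 /andP[s0 s1] sL sL2 leP leQ.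
apply: le_trans (ler_normD _ _) _; rewrite !normrM (ger0_norm s0).
rewrite ger0_norm ?subr_ge0//.
have h1 : (1 - s) * `|P| <= e * al + C * al ^+ 2.
  by apply: le_trans leP; rewrite ler_piMl// gerBl.
have h2 : s * `|Q| <= s * (e * (al + L) + C * (al + L) ^+ 2).
  by rewrite ler_wpM2l.
have h3 : e * (s * L) <= e * (3 * d) by rewrite ler_wpM2l.
have h4 : C * (s * L ^+ 2) <= C * (3 * d ^+ 2) by rewrite ler_wpM2l.
have h5 : s * (e * al) <= e * al by rewrite ler_piMl// mulr_ge0.
have h6 : s * (C * al ^+ 2) <= C * al ^+ 2.
  by rewrite ler_piMl// mulr_ge0// sqr_ge0.
have h7 : 0 <= s * (C * (al - L) ^+ 2).
  by rewrite mulr_ge0// mulr_ge0// sqr_ge0.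
have h8 : 0 <= C * (al * d) by rewrite !mulr_ge0.
have h9 : 0 <= e * al by rewrite mulr_ge0.
have h10 : 0 <= C * al ^+ 2 by rewrite mulr_ge0// sqr_ge0.
have h11 : s * (C * (al + L) ^+ 2) =
    2 * (s * (C * al ^+ 2)) + 2 * (C * (s * L ^+ 2)) - s * (C * (al - L) ^+ 2).
  by ring.
have h12 : s * (e * (al + L)) = s * (e * al) + e * (s * L) by ring.
rewrite mulrDr in h2; rewrite h11 h12 in h2.
have -> : 3 * e * (al + d) + 6 * C * (al + d) ^+ 2 =
  3 * (e * al) + e * (3 * d) + 6 * (C * al ^+ 2) + 12 * (C * (al * d)) +
  2 * (C * (3 * d ^+ 2)) by ring.
lra.
Qed.

(** On each gap, [g] interpolates [phi] by the smoothstep and is a polynomial. At [z] in [Z] the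
    difficulty is a nearby gap whose far end is not close to [z]; there flatness of [phi] is
    replaced by its boundedness, at the price of a quadratic term. *)
Lemma flat_extension Z phi : closed Z ->
  (forall x, exists2 w, Z w & w <= x) -> (forall x, exists2 w, Z w & x <= w) ->
  (exists M, forall w, Z w -> `|phi w| <= M) ->
  (forall z, Z z -> flat_within Z phi z) ->
  exists g : R -> R, [/\ forall x, derivable g x 1,
    forall z, Z z -> g z = phi z & forall z, Z z -> is_derive z (1 : R) g 0].
Proof.
move=> Zc Zl Zr [M phiM] phiZ.
have /choice[ab abP] := fun x => closed_gap Zc (Zl x) (Zr x).
pose tt x := (x - (ab x).1) / ((ab x).2 - (ab x).1).
pose g x := phi (ab x).1 + (phi (ab x).2 - phi (ab x).1) * smoothstep (tt x).
have gE x : Z x -> g x = phi x.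
  move=> Zx; have [Za Zb /andP[ax xb] /(_ x Zx)] := abP x.
  have tt0 : (ab x).1 = x -> g x = phi x.
    by move=> e; rewrite /g /tt e subrr mul0r /smoothstep expr0n /= mul0r mulr0 addr0.
  move=> [xa|bx]; first by apply: tt0; apply/eqP; rewrite eq_le ax.
  have bx' : (ab x).2 = x by apply/eqP; rewrite eq_le bx.
  have [/tt0//|ax'] := eqVneq (ab x).1 x.
  rewrite /g /tt bx' divff ?subr_eq0 1?eq_sym// /smoothstep.
  by rewrite expr1n; ring.
have gz z : Z z -> flat_within [set: R] g z.
  move=> Zz e e0; have e6 : 0 < e / 6 by rewrite divr_gt0.
  have [d0 d00 d0P] := phiZ z Zz _ e6.
  have M0 : 0 <= M by exact: le_trans (phiM z Zz).
  (* Beyond distance [d0] the increment of [phi] is at most [2 * M], which the quadratic term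
     dominates; hence [phiC] holds at every distance. *)
  pose C := 2 * M / d0 ^+ 2 + 1.
  have C0 : 0 < C.
    by rewrite ltr_wpDl// divr_ge0 ?mulr_ge0// ltW.
  have phiC w : Z w ->
      `|phi w - phi z| <= e / 6 * `|w - z| + C * `|w - z| ^+ 2.
    move=> Zw; have [wz|zw] := ltP `|w - z| d0.
      apply: le_trans (d0P w Zw wz) _.
      by rewrite lerDl mulr_ge0 ?exprn_ge0// ltW.
    apply: (@le_trans _ _ (2 * M)).
      apply: le_trans (ler_normB _ _) _.
      by have := phiM w Zw; have := phiM z Zz; lra.
    have h1 : 2 * M / d0 ^+ 2 * `|w - z| ^+ 2 >= 2 * M.
      rewrite mulrAC ler_pdivlMr ?exprn_gt0// ler_wpM2l ?mulr_ge0//.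
      by rewrite lerXn2r ?nnegrE// ltW.
    have h2 : 0 <= e / 6 * `|w - z| by rewrite mulr_ge0// ltW.
    have h3 : 0 <= `|w - z| ^+ 2 by rewrite exprn_ge0.
    by rewrite /C mulrDl mul1r; lra.
  (* Within this radius the linear and the quadratic term of the bound below each contribute at most
     [e / 2] times the distance. *)
  exists (e / (12 * C)); first by rewrite divr_gt0// mulr_gt0.
  move=> x _ xz; rewrite [g z]gE//.
  suff : `|g x - phi z| <=
      3 * (e / 6) * `|x - z| + 6 * C * `|x - z| ^+ 2.
    move=> /le_trans; apply.
    have h0 : `|x - z| * (12 * C) <= e.
      by rewrite -ler_pdivlMr ?mulr_gt0// ltW.
    have : `|x - z| * (`|x - z| * (12 * C)) <= `|x - z| * e.
      by rewrite ler_wpM2l.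
    by rewrite expr2; lra.
  have [Za Zb /andP[ax xb] /(_ z Zz)] := abP x.
  set a := (ab x).1 in Za ax *; set b := (ab x).2 in Zb xb *.
  have L0 : 0 <= b - a by lra.
  have tL : tt x * (b - a) = x - a.
    have [ab0|abn0] := eqVneq (b - a) 0; last by rewrite /tt divfK.
    by rewrite ab0 mulr0; lra.
  have t01 : 0 <= tt x <= 1.
    rewrite /tt -/a -/b; apply/andP; split.
      by rewrite divr_ge0// subr_ge0.
    have [->|ab0] := eqVneq (b - a) 0; first by rewrite invr0 mulr0.
    by rewrite ler_pdivrMr ?mul1r ?lerB// lt_neqAle eq_sym ab0.
  case=> [za|bz].
    have [s01 sL sL2] := smoothstep_bounds t01 L0.
    have -> : g x - phi z = (1 - smoothstep (tt x)) * (phi a - phi z) +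
        smoothstep (tt x) * (phi b - phi z) by rewrite /g -/a -/b; ring.
    have -> : `|x - z| = (a - z) + (x - a) by rewrite ger0_norm; lra.
    apply: (interpolation_bound (L := b - a)); rewrite ?subr_ge0// -?tL//; try lra.
    - by have := phiC a Za; rewrite (ger0_norm (x := a - z))//; lra.
    - have := phiC b Zb; rewrite (ger0_norm (x := b - z)); last lra.
      by rewrite (_ : a - z + (b - a) = b - z); last ring.
  (* When [z] lies to the right of the gap, the ends exchange roles because
     [smoothstep (1 - t) = 1 - smoothstep t]. *)
  have t01' : 0 <= 1 - tt x <= 1 by lra.
  have [s01 sL sL2] := smoothstep_bounds t01' L0.
  have -> : g x - phi z = (1 - smoothstep (1 - tt x)) * (phi b - phi z) +
      smoothstep (1 - tt x) * (phi a - phi z).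
    by rewrite /g -/a -/b /smoothstep; ring.
  have -> : `|x - z| = (z - b) + (b - x) by rewrite ler0_norm; lra.
  have tL' : (1 - tt x) * (b - a) = b - x by rewrite mulrBl tL; ring.
  apply: (interpolation_bound (L := b - a)); rewrite ?subr_ge0// -?tL'//; try lra.
  - by have := phiC b Zb; rewrite (ler0_norm (x := b - z)) ?opprB//; lra.
  - have := phiC a Za; rewrite (ler0_norm (x := a - z)) ?opprB; last lra.
    by rewrite (_ : z - b + (b - a) = z - a); last ring.
exists g; split=> // [x|z Zz]; last exact/flat_within_is_derive/gz.
have [Zx|nZx] := pselect (Z x).
  by have [] := flat_within_is_derive (gz x Zx).
have [Za Zb /andP[ax xb] gap] := abP x.
set a := (ab x).1 in Za ax gap; set b := (ab x).2 in Zb xb gap.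
have {}ax : a < x.
  by rewrite lt_neqAle ax andbT; apply/eqP => e; apply: nZx; rewrite -e.
have {}xb : x < b.
  by rewrite lt_neqAle xb andbT; apply/eqP => e; apply: nZx; rewrite e.
(* All points of the open gap have the same ends [a] and [b], so near [x] the function [g] is the
   polynomial [p]. *)
pose T := (b - a)^-1%:P * ('X - a%:P).
pose p := (phi a)%:P + (phi b - phi a)%:P * (T ^+ 2 * (3%:P - 2%:P * T)).
apply: (near_eq_derivable (f := horner p)); last exact: derivable_horner.
have near_gap : \forall y \near x, a < y < b.
  have nearl : \forall y \near x, a < y by exact: lt_nbhsr.
  have nearr : \forall y \near x, y < b by exact: lt_nbhsl.
  by apply: filterS2 nearl nearr => y -> ->.
apply: filterS near_gap => y /andP[ay yb].
have [Zay Zby /andP[ayy yby] gapy] := abP y.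
have ayE : (ab y).1 = a.
  have [?|?] := gapy _ Za; last by lra.
  by have [?|?] := gap _ Zay; lra.
have byE : (ab y).2 = b.
  have [?|?] := gapy _ Zb; first by lra.
  by have [?|?] := gap _ Zby; lra.
rewrite /g /tt ayE byE /p /T !hornerE /smoothstep /=; ring.
Qed.

End FlatExtension.

(** * Embedding with vanishing derivative is equivalent to having a flat embedding *)

Section EmbeddableFlat.
Variables (R : realType) (X : metricType R) (f : X -> X).

Lemma derive1_0_flat_within (g : R -> R) z :
  derivable g z 1 -> (g^`() z)%classic = 0 -> flat_within [set: R] g z.
Proof.
rewrite derive1E => gz g'z e e0.
have : (fun h => h^-1 *: ((g \o shift z) (h *: 1) - g z)) @ 0^' -->
    'D_1 g z := gz.
rewrite g'z => /cvgrPdist_le /(_ e e0) [d /= d0 dP]; exists d => // w _ wz.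
have [->|wnz] := eqVneq w z; first by rewrite !subrr normr0 mulr0.
have wz0 : w - z != 0 by rewrite subr_eq0.
have := dP (w - z); rewrite /= !sub0r !normrN => /(_ wz wz0).
rewrite [_ *: 1]mulr1 /shift/= subrK normrM normfV.
by rewrite ler_pdivrMl ?normr_gt0// mulrC.
Qed.

Lemma embeddable_flat_embedding :
  embeddable_with_vanishing_derivative f ->
  exists psi : X -> R, flat_embedding f psi.
Proof.
move=> [g [Z [psi [psiinv [gd _ [psic _ psiK psiinvK] gE g'0]]]]].
exists (fun x => \val (psi x)).
have valc : continuous (fun x => \val (psi x)).
  move=> x; apply: continuous_comp; first exact: psic.
  exact: initial_continuous.
split=> // [x y /val_inj /(can_inj psiK)//|x e e0].
have Zx : Z (\val (psi x)) by exact: set_valP.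
have [d d0 dP] := derive1_0_flat_within (gd _) (g'0 _ Zx) e0.
have fE y : \val (psi (f y)) = g (\val (psi y)) by rewrite gE psiK.
have : \forall y \near x, `|\val (psi x) - \val (psi y)| < d.
  exact: (valc x _ (nbhsx_ballx (\val (psi x)) _ d0)).
by apply: filterS => y; rewrite distrC !fE; exact: dP.
Qed.

Hypothesis cptX : compact [set: X].

(** The conjugate of [f] by [psi], set to 0 off the image, is flat within a closed set containing
    the image; [flat_extension] then provides [g]. *)
Lemma flat_embedding_embeddable (psi : X -> R) :
  flat_embedding f psi -> embeddable_with_vanishing_derivative f.
Proof.
move=> [psic psiI psif].
have Zcpt : compact (range psi).
  by apply: continuous_compact => //; exact: continuous_subspaceT.
have [M MP] : exists M : R, forall x, `|psi x| <= M.
  have [M [_ MP]] := compact_bounded Zcpt; exists (`|M| + 1) => x.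
  by apply: MP; [rewrite ltr_pwDr// ler_norm|exists x].
have /choice[phi phiP] : forall w, exists v,
    (forall x, w = psi x -> v = psi (f x)) /\ (~ range psi w -> v = 0).
  move=> w; have [[x _ <-]|nw] := pselect (range psi w).
    by exists (psi (f x)); split => [y /psiI ->//|[]]; exists x.
  by exists 0; split=> // x wx; case: nw; exists x.
have phipsi x : phi (psi x) = psi (f x) by exact: (phiP (psi x)).1.
have far_phi w : M < `|w| -> phi w = 0.
  move=> Mw; apply: (phiP w).2 => -[x _ xw].
  by have := MP x; rewrite xw leNgt Mw.
(* Two far rays are added so that every point lies between two points of [Z']. *)
pose Z' := range psi `|` [set w | M + 1 <= `|w|].
have [||||z|g [gd gE g0]] := @flat_extension R Z' phi.
- apply: closedU; first exact: compact_closed Zcpt.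
  apply: (@closed_comp _ _ (fun w : R => `|w|) [set u | M + 1 <= u]).
    by move=> w _; exact: norm_continuous.
  exact: closed_ge.
- move=> x; exists (- (`|M| + 1 + `|x|)).
    right => /=; rewrite normrN ger0_norm ?addr_ge0//.
    by have := ler_norm M; have := normr_ge0 x; lra.
  by have := ler_norm (- x); rewrite normrN; have := normr_ge0 M; lra.
- move=> x; exists (`|M| + 1 + `|x|).
    right => /=; rewrite ger0_norm ?addr_ge0//.
    by have := ler_norm M; have := normr_ge0 x; lra.
  by have := ler_norm x; have := normr_ge0 M; lra.
- exists `|M| => w [[x _ <-]|Mw].
    by rewrite phipsi; apply: le_trans (MP _) (ler_norm _).
  by rewrite far_phi ?normr0//; move: Mw => /=; lra.
- move=> [[x _ <-]|Mz] e e0.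
    have [d d0 dP] := compact_embedding_nbhs cptX psic psiI (psif x e e0).
    (* No point of the far rays is at distance less than 1 from the image. *)
    exists (Num.min d 1); first by rewrite lt_min d0 ltr01.
    move=> w Zw; rewrite lt_min => /andP[wd w1].
    case: Zw => [[y _ yw]|]; first by move: wd; rewrite -yw !phipsi; exact: dP.
    move=> /= Mw; have := MP x; have := ler_dist_dist w (psi x).
    by have := ler_norm (`|w| - `|psi x|); lra.
  exists 1 => // w _ wz; rewrite /= in Mz.
  have zw : `|z| - `|w| <= `|w - z|.
    by rewrite -[leRHS]normrN opprB; exact: lerB_dist.
  by rewrite !far_phi ?subrr ?normr0 ?mulr_ge0 ?(ltW e0)//; lra.
pose Z := range psi.
have Zpsi x : psi x \in Z by apply/mem_set; exists x.
have /choice[inv invP] : forall z : Z, exists x, psi x = \val z.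
  by move=> z; have [x _ xz] := set_valP z; exists x.
exists g, Z, (fun x => exist _ (psi x) (Zpsi x) : Z), inv; split=> //.
- split; first exact: compact_closed Zcpt.
  move=> _ [_ [x _ <-] <-]; rewrite gE; last by left; exists x.
  by rewrite phipsi; exists (f x).
- split.
  + by apply: continuous_comp_initial; exact: psic.
  + move=> z U zU.
    have [d d0 dP] := compact_embedding_nbhs cptX psic psiI zU.
    have valc : continuous (fun z : Z => \val z) by exact: initial_continuous.
    have : \forall w \near z, `|\val z - \val w| < d.
      exact: (valc z _ (nbhsx_ballx (\val z) _ d0)).
    apply: (@filterS _ _ (nbhs_filter z)) => w wz; rewrite /= in wz *; apply: dP.
    by rewrite !invP distrC.
  + by move=> x; apply: psiI; rewrite invP.
  + by move=> z; apply: val_inj; rewrite /= invP.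
- by move=> z; rewrite /= -(invP z) gE ?phipsi//; left; exists (inv z).
- move=> z Zz; rewrite derive1E.
  by have [_ ->] := g0 z (or_introl Zz).
Qed.

End EmbeddableFlat.

(** * Clopen neighbourhoods of attracting periodic orbits *)

Section Shadowing.
Variables (R : realType) (X : metricType R) (f : X -> X) (q : nat -> X -> nat).
Hypothesis cptX : compact [set: X].
Hypothesis fc : continuous f.
Hypothesis qscale : clopen_scale q.

Lemma scale_separates x y : (forall n, q n x = q n y) -> x = y.
Proof.
move=> qxy; apply: (@metric_hausdorff R X) => A B xA yB.
have [_ _ /(_ _ _ xA)[n nA]] := qscale.
by exists y; split; [exact/nA/esym|exact: nbhs_singleton].
Qed.

Definition periodic_point t := exists2 k, (0 < k)%N & iter k f t = t.

(* [N a] is the time from which orbits are known to be within scale [a] of the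
   attractor.  Shifting time by one shifts [m] by one, so [f] maps the [m]-th
   neighbourhood of [t] into the [m.+1]-st one of [f t]; attraction makes all but
   finitely many of the conditions redundant, so these neighbourhoods are clopen. *)
Definition shadow (N : nat -> nat) m t x :=
  forall a j, (N a <= m + j)%N -> q a (iter j f x) = q a (iter j f t).

Lemma shadow_refl N m t : shadow N m t t.
Proof. by []. Qed.

Lemma shadow_mono N m n t x : (m <= n)%N -> shadow N n t x -> shadow N m t x.
Proof. by move=> mn tx a j Na; apply: tx; rewrite (leq_trans Na)// leq_add2r. Qed.

Lemma shadow_step N m t x : shadow N m t x -> shadow N m.+1 (f t) (f x).
Proof. by move=> tx a j; rewrite addSnnS -!iterSr; exact: tx. Qed.

Lemma shadow_scale N a t x : shadow N (N a) t x -> q a x = q a t.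
Proof. by move=> /(_ a 0%N); rewrite addn0; exact. Qed.

Lemma iter_periodic k t j : iter k f t = t -> iter (j * k) f t = t.
Proof. by move=> kt; elim: j => // j IHj; rewrite mulSn iterD IHj kt. Qed.

(** At a late time divisible by both periods, the iterate of [x] has the label of [t] and that of
    [u], for any prescribed scale. *)
Lemma shadow_unique N M m n t u x : periodic_point t -> periodic_point u ->
  shadow N m t x -> shadow M n u x -> t = u.
Proof.
move=> [k k0 kt] [l l0 lu] tx ux; apply: scale_separates => a.
pose j := (maxn (N a) (M a) * (k * l))%N.
have jmax : (maxn (N a) (M a) <= j)%N by rewrite leq_pmulr// muln_gt0 k0.
have jt : iter j f t = t.
  by rewrite /j (mulnC k) mulnA; exact: iter_periodic.
have ju : iter j f u = u by rewrite /j mulnA; exact: iter_periodic.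
rewrite -{1}jt -{1}ju -tx ?ux// (leq_trans _ (leq_addl _ _))//.
  by rewrite (leq_trans (leq_maxr _ _) jmax).
by rewrite (leq_trans (leq_maxl _ _) jmax).
Qed.

Lemma continuous_iter n : continuous (iter n f).
Proof.
elim: n => [|n IHn] x; first exact: cvg_id.
by apply: (@continuous_comp _ _ _ (iter n f) f); [exact: IHn|exact: fc].
Qed.

(** Otherwise late iterates missing the orbit at scale [a] cluster at some [y]. Every [f^m(u)] is
    closed and contains all sufficiently late iterates, so [y] is in the intersection, that is, on
    the orbit. *)
Lemma attracting_uniform (s : seq X) (u : set X) a :
  stable f u -> closed u ->
  \bigcap_(n in [set: nat]) (iter n f @` u) = [set t | t \in s] ->
  exists N, forall n, (N <= n)%N -> forall x, u x ->
    exists2 t, t \in s & q a (iter n f x) = q a t.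
Proof.
move=> fu uc us; apply: contrapT => /forallNP noN.
have /choice[nx nxP] : forall N, exists nx : nat * X, [/\ (N <= nx.1)%N,
    u nx.2 & forall t, t \in s -> q a (iter nx.1 f nx.2) <> q a t].
  move=> N; apply: contrapT => nox; apply: (noN N) => n Nn x ux.
  apply: contrapT => nt; apply: nox; exists (n, x); split=> // t ts e.
  by apply: nt; exists t.
have [y yP] := compact_cluster_seq cptX (fun N => iter (nx N).1 f (nx N).2).
have iteru n x : u x -> u (iter n f x).
  by move=> ux; elim: n => //= n un; apply: fu; exists (iter n f x).
have ys : y \in s.
  suff : (\bigcap_(n in [set: nat]) (iter n f @` u)) y by rewrite us.
  move=> m _.
  have imc : closed (iter m f @` u).
    apply: compact_closed; first exact: metric_hausdorff.
    apply: continuous_compact; last exact: subclosed_compact cptX _.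
    exact/continuous_subspaceT/continuous_iter.
  apply: imc => U yU; have [n mn Un] := yP _ yU m.
  have [nn un _] := nxP n; exists (iter (nx n).1 f (nx n).2); split => //.
  exists (iter ((nx n).1 - m) f (nx n).2); first exact: iteru.
  by rewrite -iterD subnKC// (leq_trans mn).
have [qlc _ _] := qscale; have [n _ /= e] := yP _ (qlc a y) 0%N.
by have [_ _ /(_ _ ys)] := nxP n.
Qed.

(** Labels at scale [i0] separate orbit points and force membership in [u]; labels at scale [i1]
    control those at [i0] one step later. At late times attraction brings the iterate near some
    orbit point at each required scale, and [i0] shows that it is the expected one, so only finitely
    many conditions remain. *)
Lemma exists_shadow (p : set X) : finite_orbit f p -> attracting f p ->
  exists N, forall m t, p t -> locally_constant (shadow N m t).
Proof.
move=> /finite_orbit_seq[k [s [k0 -> fs sk]]] [u [fu ucl su us]].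
have [qlc qn qb] := qscale.
have siter j t : t \in s -> iter j f t \in s.
  by move=> ts; elim: j => //= j /fs.
have [i0 i0P] : exists i0, forall t, t \in s ->
    (forall x, q i0 x = q i0 t -> u x) /\
    (forall t', t' \in s -> q i0 t = q i0 t' -> t = t').
  apply: uniform_nat_seq => [t n m nm [tu tI]|t ts].
    split=> [x /(qn _ _ _ _ nm) /tu//|t' t's /(qn _ _ _ _ nm) /tI]; exact.
  have [n nu] := qb t u (open_nbhs_nbhs (conj ucl.1 (su t ts))).
  have [m mP] : exists m, forall t', t' \in s -> q m t = q m t' -> t = t'.
    apply: uniform_nat_seq => [t' i j ij it /(qn _ _ _ _ ij)//|t' t's].
    have [//|tt'] := pselect (t = t'); first by exists 0%N.
    apply: contrapT => /forallNP noq; apply: tt'.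
    apply: scale_separates => i.
    by apply: contrapT => qi; apply: (noq i) => /qi.
  exists (maxn n m); split.
    by move=> x /(qn _ _ _ _ (leq_maxl _ _)); exact: nu.
  by move=> t' t's /(qn _ _ _ _ (leq_maxr _ _)); exact: mP.
have [i1 i1P] : exists i1, forall t, t \in s -> (i0 <= i1)%N /\
    forall x, q i1 x = q i1 t -> q i0 (f x) = q i0 (f t).
  apply: uniform_nat_seq => [t n m nm [i0n tu]|t ts].
    by split; [exact: leq_trans i0n nm|move=> x /(qn _ _ _ _ nm) /tu].
  have [n nP] := qb t _ (lc_comp_continuous fc (qlc i0) t).
  exists (maxn i0 n); split; first exact: leq_maxl.
  by move=> x /(qn _ _ _ _ (leq_maxr _ _)); exact: nP.
have /choice[N0 N0P] := fun a => attracting_uniform a fu ucl.2 us.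
(* Scales up to [i1] are imposed at all times, which feeds the induction. For other scales, the
   factor 2 gives [N0 a <= j] once [j] exceeds [m], and the term [a] leaves finitely many scales to
   check at early times. *)
pose N a := if (a <= i1)%N then 0%N else (2 * maxn (N0 a) a)%N.
exists N => m t ts x; have {ts} ts : t \in s by [].
have i01 : (i0 <= i1)%N by have [] := i1P t ts.
have [tx|ntx] := pselect (shadow N m t x); last first.
  have [a [j [Na ne]]] : exists a j, (N a <= m + j)%N /\
      q a (iter j f x) <> q a (iter j f t).
    apply: contrapT => /forallNP noa; apply: ntx => a j Na.
    by apply: contrapT => ne; apply: (noa a); exists j.
  apply: filterS (lc_iter j fc (qlc a) x) => y yx.
  by apply/propext; split=> // ty; case: ne; rewrite -yx; exact: ty.
pose J := maxn m (N0 i1); pose A := maxn i1 (m + J).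
have : \forall y \near x, forall j, (j < J.+1)%N -> forall a, (a < A.+1)%N ->
    q a (iter j f y) = q a (iter j f x).
  by apply: near_all_ltn => j _; apply: near_all_ltn => a _; exact: lc_iter.
apply: filterS => y yx; apply/propext; split=> // _.
have ty j a : (j <= J)%N -> (N a <= m + j)%N ->
    q a (iter j f y) = q a (iter j f t).
  move=> jJ Na; rewrite yx ?ltnS//; first exact: tx.
  move: Na; rewrite /N /A; case: (leqP a i1) => [ai1 _|_ Na]; first by rewrite leq_max ai1.
  by rewrite leq_max; apply/orP; right; lia.
have Ni1 : N i1 = 0%N by rewrite /N leqnn.
have uy : u y.
  apply: (i0P t ts).1; apply: qn i01 _.
  by apply: (ty 0%N i1) => //; rewrite Ni1.
move=> a j; elim: j a => [a|j IHj a Na]; first exact: ty.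
have [jJ|Jj] := leqP j.+1 J; first exact: ty.
have e0 : q i0 (iter j.+1 f y) = q i0 (iter j.+1 f t).
  by apply: (i1P _ (siter j t ts)).2; apply: IHj; rewrite Ni1.
have N0j : (N0 (maxn a i1) <= j.+1)%N.
  move: Na Jj; rewrite /N /J; have [ai1|i1a] := leqP a i1; lia.
have [t' t's e1] := N0P _ _ N0j _ uy.
have i0a : (i0 <= maxn a i1)%N by rewrite leq_max i01 orbT.
have tt' : iter j.+1 f t = t'.
  apply: (i0P _ (siter j.+1 t ts)).2 => //.
  by rewrite -e0; exact: qn i0a e1.
by rewrite tt'; apply: qn (leq_maxl a i1) e1.
Qed.

End Shadowing.

(** * Tubes around periodic points and disjoint markers *)

Lemma lc_exists_seq (X : topologicalType) (I : eqType) (s : seq I)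
    (A : I -> set X) :
  (forall i, i \in s -> locally_constant (A i)) ->
  locally_constant (fun x => exists2 i, i \in s & A i x).
Proof.
move=> Alc x; have : \forall y \near x, forall i, i \in s -> A i y = A i x.
  by apply: near_all_seq => i /Alc; exact.
apply: filterS => y yx; apply/propext.
split=> [[i si Ai]|[i si Ai]].
  by exists i; rewrite -?(yx i si).
by exists i; rewrite ?(yx i si).
Qed.

Section Tubes.
Variables (R : realType) (X : metricType R) (f : X -> X) (q : nat -> X -> nat).
Hypothesis cptX : compact [set: X].
Hypothesis bX : clopen_base X.
Hypothesis fc : continuous f.
Hypothesis qscale : clopen_scale q.

(** These are the properties of [shadow] used from here on: clopen neighbourhoods shrinking to each
    periodic point, disjoint for distinct points at any depths, whose depth grows by one under
    [f]. *)
Record tubes (V : nat -> X -> set X) : Prop := {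
  tube_lc : forall m t, periodic_point f t -> locally_constant (V m t);
  tube_refl : forall m t, V m t t;
  tube_step : forall m t x, periodic_point f t -> V m t x -> V m.+1 (f t) (f x);
  tube_mono : forall m n t x, (m <= n)%N -> V n t x -> V m t x;
  tube_scale : forall a t, exists m, forall x, V m t x -> q a x = q a t;
  tube_unique : forall m n t u x, periodic_point f t -> periodic_point f u ->
    V m t x -> V n u x -> t = u }.

Lemma periodic_orbit_seq t : periodic_point f t ->
  exists s : seq X, [/\ t \in s, forall u, u \in s -> f u \in s &
    forall u, u \in s -> periodic_point f u].
Proof.
move=> [k k0 kt]; pose p := [set iter i f t | i in `I_k].
have [|l [s [l0 ps fs sl]]] := @finite_orbit_seq X f p; first by exists t, k.
exists s; split=> // [|u us]; last by exists l => //; exact: sl.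
suff : p t by rewrite ps.
by exists 0%N.
Qed.

(** The times [N] depend on the orbit only, so [shadow_step] stays inside one family. *)
Lemma attracting_tubes :
  (forall p : set X, finite_orbit f p -> attracting f p) ->
  exists V, tubes V.
Proof.
move=> attr; pose orb t := [set iter i f t | i in [set: nat]].
have orb_finite t : periodic_point f t -> finite_orbit f (orb t).
  move=> [k k0 kt]; exists t, k; split=> //.
  apply/seteqP; split=> [_ [i _ <-]|_ [i _ <-]]; last by exists i.
  exists (i %% k)%N; first by rewrite /= ltn_mod.
  by rewrite {2}(divn_eq i k) addnC iterD iter_periodic.
have orb_step t : periodic_point f t -> orb (f t) = orb t.
  move=> [k k0 kt]; apply/seteqP; split=> [_ [i _ <-]|_ [i _ <-]].
    by exists i.+1; rewrite // iterSr.
  exists (i + k.-1)%N => //.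
  by rewrite -iterSr -addnS prednK// iterD kt.
have /choice[N NP] : forall p : set X, exists N, finite_orbit f p ->
    forall m t, p t -> locally_constant (shadow f q N m t).
  move=> p; have [pf|npf] := pselect (finite_orbit f p).
    by have [N NP] := exists_shadow cptX fc qscale pf (attr p pf); exists N.
  by exists id.
exists (fun m t => shadow f q (N (orb t)) m t); split.
- move=> m t tp; apply: NP; first exact: orb_finite.
  by exists 0%N.
- by move=> m t; exact: shadow_refl.
- by move=> m t x tp; rewrite orb_step//; exact: shadow_step.
- by move=> m n t x; exact: shadow_mono.
- by move=> a t; exists (N (orb t) a) => x; exact: shadow_scale.
- by move=> m n t u x; exact: shadow_unique.
Qed.

Variable V : nat -> X -> set X.
Hypothesis tubesV : tubes V.

Definition in_tubes (D : seq X) x := exists2 t, t \in D & V 0 t x.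

Definition periodic_family (D : seq X) :=
  (forall t, t \in D -> periodic_point f t) /\ (forall t, t \in D -> f t \in D).

Lemma periodic_familyS (D : seq X) : (forall t, t \in D -> periodic_point f t) ->
  exists D', periodic_family D' /\ {subset D <= D'}.
Proof.
elim: D => [|t D IHD] Dp; first by exists [::].
have [|D' [[D'p D'f] DD']] := IHD.
  by move=> u uD; apply: Dp; rewrite inE uD orbT.
have [s [ts sf sp]] := periodic_orbit_seq (Dp t (mem_head _ _)).
exists (s ++ D'); split; first split.
- by move=> u; rewrite mem_cat => /orP[/sp|/D'p].
- by move=> u; rewrite !mem_cat => /orP[/sf ->|/D'f ->]; rewrite ?orbT.
- move=> u; rewrite inE mem_cat => /predU1P[->|/DD' ->]; first by rewrite ts.
  by rewrite orbT.
Qed.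

Definition hits (A B : set X) := forall x, exists j, A (iter j f x) \/ B (iter j f x).

Lemma in_tubes_lc D : periodic_family D -> locally_constant (in_tubes D).
Proof.
by move=> [Dp _]; apply: lc_exists_seq => t /Dp; exact: (tube_lc tubesV).
Qed.

Lemma bounded_hit (A : set X) : locally_constant A ->
  (forall x, exists j, A (iter j f x)) ->
  exists T, forall x, exists2 j, (j < T)%N & A (iter j f x).
Proof.
move=> Alc /(hitting_time fc Alc)[tau [/(lc_bounded cptX)[T TP] tauA _]].
by exists T => x; exists (tau x).
Qed.

(** A non-periodic point has a neighbourhood disjoint from its first [T] images, while a periodic
    point is covered by its tube and joins [D']. The colour is the label of a finite clopen
    partition refining these neighbourhoods. *)
Lemma exists_coloring T (D : seq X) : periodic_family D ->
  exists (D' : seq X) (c : X -> nat), [/\ periodic_family D',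
    {subset D <= D'}, locally_constant c &
    forall x j, ~ in_tubes D' x -> (0 < j <= T)%N -> c x <> c (iter j f x)].
Proof.
move=> [Dp Df]; have [qlc qn qb] := qscale.
have /choice[U UP] : forall z, exists U : set X, nbhs z U /\
    (periodic_point f z /\ U = V 0 z \/
     forall y j, (0 < j <= T)%N -> U y -> ~ U (iter j f y)).
  move=> z; have [zp|nzp] := pselect (periodic_point f z).
    exists (V 0 z); split; last by left.
    have := tube_lc tubesV 0 zp z; apply: filterS => y ->.
    exact: (tube_refl tubesV).
  have [n nP] : exists n, forall j, j \in iota 1 T -> q n z <> q n (iter j f z).
    apply: uniform_nat_seq => [j m n mn zj e|j].
      by apply: zj; exact: qn mn e.
    rewrite mem_iota => /andP[j0 _].
    apply: contrapT => /forallNP noq; apply: nzp; exists j => //.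
    apply/esym/(scale_separates qscale) => n.
    by apply: contrapT => /noq.
  exists (fun y => forall j, (j < T.+1)%N -> q n (iter j f y) = q n (iter j f z)).
  split; first by apply: near_all_ltn => j _; exact: lc_iter.
  right=> y j /andP[j0 jT] yU /(_ 0%N isT) /= e.
  apply: (nP j); first by rewrite mem_iota j0 add1n ltnS.
  by rewrite -e yU.
have [D0 [c [clc cP]]] := lc_partition cptX bX (fun z => (UP z).1).
have [|D' [[D'p D'f] DD']] :=
  @periodic_familyS (D ++ [seq t <- D0 | `[< periodic_point f t >]]).
  move=> t; rewrite mem_cat => /orP[/Dp//|].
  by rewrite mem_filter => /andP[/asboolP].
exists D', c; split=> // [t tD|x j xD' jT cx].
  by apply: DD'; rewrite mem_cat tD.
have [z zD0 zU] := cP x; have [_ [[zp UV]|zdis]] := UP z.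
  apply: xD'; exists z; last by rewrite -UV; exact: zU.
  by apply: DD'; rewrite mem_cat mem_filter zD0 andbT; apply/orP; right; apply/asboolP.
exact: (zdis x j jT (zU x erefl) (zU _ (esym cx))).
Qed.

(* [C'] collects the points of [C] whose colour is smaller than at all their
   visits to [C] during the next [T] steps: along an orbit with bounded return
   times to [C], colours cannot increase forever, nor decrease forever. *)
Lemma split_marker (D : seq X) (C : set X) :
  periodic_family D -> locally_constant C -> hits C (in_tubes D) ->
  exists (D' : seq X) (C' : set X), [/\ periodic_family D',
    locally_constant C', {subset D <= D'} & C' `<=` C] /\
    hits C' (in_tubes D') /\ hits (C `\` C') (in_tubes D').
Proof.
move=> Dper Clc Chit.
have Alc : locally_constant (fun x => C x \/ in_tubes D x).
  exact: (lc_comp (fun p => p.1 \/ p.2) (lc_pair Clc (in_tubes_lc Dper))).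
have [T TP] := bounded_hit Alc Chit.
have [D' [c [D'per DD' clc cP]]] := exists_coloring T Dper.
pose above x j := (0 < j)%N -> C (iter j f x) -> (c x < c (iter j f x))%N.
pose C' x := C x /\ forall j, (j < T.+1)%N -> above x j.
have C'lc : locally_constant C'.
  move=> x; have near_c : \forall y \near x, forall j, (j < T.+1)%N ->
      (C (iter j f y), c (iter j f y)) = (C (iter j f x), c (iter j f x)).
    by apply: near_all_ltn => j _; exact: (lc_iter j fc (lc_pair Clc clc)).
  apply: filterS near_c => y yx; have [C0 c0] := yx 0%N isT.
  rewrite /C' -{1}C0 /=; apply/propext; split=> -[Cy yj]; split=> // j jT;
    by have := yj j jT; have [Cj cj] := yx j jT; rewrite /above /= c0 Cj cj.
exists D', C'; split; first by split=> // x [].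
(* Avoiding the tubes of [D'] implies avoiding those of [D], so such an orbit meets [C] within any
   [T] consecutive steps. *)
have revisit x : (forall j, ~ in_tubes D' (iter j f x)) -> forall i,
    exists2 j, (0 < j <= T)%N & C (iter (j + i) f x).
  move=> nD' i; have [j jT [Cj|[t tD tj]]] := TP (iter i.+1 f x).
    by exists j.+1; rewrite // addSnnS iterD.
  by case: (nD' (j + i.+1)%N); exists t; [exact: DD'|rewrite iterD].
have [M MP] := lc_bounded cptX clc.
split=> x.
  have [[j xj]|/forallNP nD'] := pselect (exists j, in_tubes D' (iter j f x)).
    by exists j; right.
  suff C'hit n i : C (iter i f x) -> (c (iter i f x) < n)%N ->
      exists j, C' (iter j f x).
    have [i _ Ci] := revisit x nD' 0%N.
    by have [j C'j] := C'hit _ _ Ci (ltnSn _); exists j; left.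
  (* A visit to [C] outside [C'] is followed by one of smaller colour; equality is excluded by the
     colouring. *)
  elim: n i => // n IHn i Ci cin.
  have [C'i|nC'i] := pselect (C' (iter i f x)); first by exists i.
  have [j [/andP[j0 jT] Cj cj]] : exists j, [/\ (0 < j <= T)%N,
      C (iter j f (iter i f x)) & (c (iter j f (iter i f x)) <= c (iter i f x))%N].
    apply: contrapT => /forallNP noj; apply: nC'i; split=> // j jT j0 Cj.
    by rewrite ltnNge; apply/negP => cj; apply: (noj j); rewrite j0.
  apply: (IHn (j + i)%N); rewrite iterD//.
  rewrite -ltnS (leq_trans _ cin)// ltnS ltn_neqAle cj andbT.
  by apply/eqP => e; apply: (cP (iter i f x) j); rewrite ?j0//.
have [[j xj]|/forallNP nD'] := pselect (exists j, in_tubes D' (iter j f x)).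
  by exists j; right.
suff Bhit n i : C (iter i f x) -> (M - c (iter i f x) < n)%N ->
    exists j, (C `\` C') (iter j f x).
  have [i _ Ci] := revisit x nD' 0%N.
  by have [j Bj] := Bhit _ _ Ci (ltnSn _); exists j; left.
(* A visit to [C'] is followed by a visit to [C] of larger colour, and colours stay below [M]. *)
elim: n i => // n IHn i Ci cin.
have [[_ C'i]|nC'i] := pselect (C' (iter i f x)); last by exists i.
have [j /andP[j0 jT] Cj] := revisit x nD' i.
have := C'i j jT j0; rewrite -iterD => /(_ Cj) cj.
apply: (IHn (j + i)%N Cj).
by have := MP (iter (j + i) f x); lia.
Qed.

(** Iterating [split_marker] from the whole space gives decreasing sets; the markers are their
    successive differences, hence disjoint. *)
Lemma exists_markers : exists (D : nat -> seq X) (B : nat -> set X),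
  [/\ forall n, periodic_family (D n), forall n, {subset D n <= D n.+1},
      forall n, locally_constant (B n), forall m n x, B m x -> B n x -> m = n &
      forall n, hits (B n) (in_tubes (D n))].
Proof.
pose inv (S : seq X * set X) := [/\ periodic_family S.1,
  locally_constant S.2 & hits S.2 (in_tubes S.1)].
pose step (S S' : seq X * set X) := [/\ {subset S.1 <= S'.1}, S'.2 `<=` S.2 &
  hits (S.2 `\` S'.2) (in_tubes S'.1)].
have /choice[F FP] : forall S, exists S', inv S -> inv S' /\ step S S'.
  move=> [D C]; have [[Dper Clc Chit]|nS] := pselect (inv (D, C)).
    have [D' [C' [[? ? ? ?] [? ?]]]] := split_marker Dper Clc Chit.
    by exists (D', C').
  by exists ([::], setT).
pose S n := iter n F ([::], setT).
have Sinv n : inv (S n).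
  elim: n => [|n /FP[]//]; split=> [|x|x] /=; first by split.
    exact: nearW.
  by exists 0%N; left.
have Sstep n : step (S n) (S n.+1) by have [] := FP _ (Sinv n).
have Cmono m n : (m <= n)%N -> (S n).2 `<=` (S m).2.
  elim: n => [|n IHn]; first by rewrite leqn0 => /eqP ->.
  rewrite leq_eqVlt => /predU1P[->//|/IHn mn x].
  by have [_ nn _] := Sstep n; move=> /nn /mn.
exists (fun n => (S n.+1).1), (fun n => (S n).2 `\` (S n.+1).2); split=> n.
- by have [] := Sinv n.+1.
- by have [] := Sstep n.+1.
- have [_ Clc _] := Sinv n; have [_ C'lc _] := Sinv n.+1.
  exact: (lc_comp (fun p => p.1 /\ ~ p.2) (lc_pair Clc C'lc)).
- move=> m x [nx nx1] [mx mx1]; apply/eqP; rewrite eqn_leq.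
  by apply/andP; split; rewrite leqNgt; apply/negP => /Cmono; [move=> /(_ _ nx)|move=> /(_ _ mx)].
- by have [] := Sstep n.
Qed.

End Tubes.

(** * Nested clopen partitions with rank functions *)

Section Partitions.
Variables (R : realType) (X : metricType R) (f : X -> X) (q : nat -> X -> nat).
Hypothesis fc : continuous f.
Hypothesis qscale : clopen_scale q.
Variable V : nat -> X -> set X.
Hypothesis tubesV : tubes f q V.

Definition tube_union (D : seq X) (s : X -> nat) x :=
  exists2 t, t \in D & V (s t) t x.

(** The invariant of the recursion: [s t] is a depth at which the tube of [t] lies in one class. *)
Definition tube_partition (D : seq X) (pi s : X -> nat) :=
  [/\ locally_constant pi, forall t, t \in D -> s (f t) = s t &
      forall t x, t \in D -> V (s t) t x -> pi x = pi t].

(** Old depths grow by exactly one to match [tube_step]: [f] then sends a tube of one partition into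
    a tube, hence a class, of the next. Outside the tubes, [h] serves as the rank. *)
Definition partition_step n (B : set X) (D0 D1 : seq X)
    (pi s pi' s' h : X -> nat) :=
  [/\ locally_constant h,
      forall x y, pi' x = pi' y -> pi x = pi y /\ h x = h y,
      forall t, t \in D0 -> s' t = (s t).+1,
      forall t x y, t \in D1 -> V (s' t) t x -> pi' x = pi' y -> V (s' t) t y &
      forall x, ~ tube_union D1 s' x ->
        (forall y, pi' x = pi' y -> q n x = q n y) /\
        (~ B x -> (h (f x) < h x)%N /\
          forall y, pi' x = pi' y -> pi' (f x) = pi' (f y))].

Lemma periodic_family_inv (D : seq X) t :
  periodic_family f D -> periodic_point f t -> (f t \in D) = (t \in D).
Proof.
move=> [_ Df] [k k0 kt]; apply/idP/idP; last exact: Df.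
have fiter j u : u \in D -> iter j f u \in D by move=> uD; elim: j => //= j /Df.
by move=> /(fiter k.-1); rewrite -iterSr prednK// kt.
Qed.

(** Once in a tube of depth 0, an orbit gains one level per step, and the target depth [s] does not
    change along the periodic orbit. *)
Lemma hits_tube_union (B : set X) (D : seq X) (s : X -> nat) :
  periodic_family f D -> (forall t, t \in D -> s (f t) = s t) ->
  hits f B (in_tubes V D) ->
  forall x, exists j, B (iter j f x) \/ tube_union D s (iter j f x).
Proof.
move=> [Dp Df] sf hit x; have [j [Bj|[t tD tj]]] := hit x.
  by exists j; left.
exists (s t + j)%N; right.
have tube_iter i : [/\ iter i f t \in D, s (iter i f t) = s t &
    V i (iter i f t) (iter (i + j) f x)].
  elim: i => // i [iD si Vi]; split; first exact: Df.
    by rewrite iterS sf.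
  exact: (tube_step tubesV (Dp _ iD) Vi).
have [iD si Vi] := tube_iter (s t).
by exists (iter (s t) f t); rewrite ?si.
Qed.

(** The new label is the itinerary up to the first visit to [B] or to a tube, and the rank is the
    time of that visit. Before it, applying [f] deletes the first letter, which preserves classes
    and lowers the rank. *)
Lemma exists_partition_step n (B : set X) (D0 D1 : seq X) (pi s : X -> nat) :
  periodic_family f D0 -> periodic_family f D1 -> {subset D0 <= D1} ->
  locally_constant B -> hits f B (in_tubes V D1) -> tube_partition D0 pi s ->
  exists pi' s' h, tube_partition D1 pi' s' /\
    partition_step n B D0 D1 pi s pi' s' h.
Proof.
move=> D0per D1per D01 Blc hit [pilc sf spi]; have [qlc qn qb] := qscale.
have [D1p D1f] := D1per.
(* The depth given to the newly added periodic points, large enough for [pi] to be constant on their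
   tubes. *)
have [S SP] : exists S, forall t, t \in D1 -> forall x, V S t x -> pi x = pi t.
  apply: (uniform_nat_seq (P := fun t i => forall x, V i t x -> pi x = pi t))
    => [t i j ij ti x|t tD].
    by move=> /(tube_mono tubesV ij) /ti.
  have [a aP] := qb t _ (pilc t).
  have [m mP] := tube_scale tubesV a t.
  by exists m => x /mP /aP.
pose s' t := if t \in D0 then (s t).+1 else S.
have s'pi t x : t \in D1 -> V (s' t) t x -> pi x = pi t.
  move=> tD; rewrite /s'; case: ifP => [tD0|_]; last exact: SP.
  by move=> /(tube_mono tubesV (leqnSn _)); exact: spi.
have s'f t : t \in D1 -> s' (f t) = s' t.
  move=> /D1p tp; rewrite /s' periodic_family_inv//.
  by case: ifP => // tD0; rewrite sf.
pose inV x t := `[< V (s' t) t x >].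
pose tag x := find (inV x) D1.
have tagE x : (tag x < size D1)%N = `[< tube_union D1 s' x >].
  rewrite -has_find; apply/hasP/asboolP => -[t tD].
    by move=> /asboolP; exists t.
  by move=> ?; exists t => //; exact/asboolP.
have tag_nth x d : (tag x < size D1)%N ->
    nth d D1 (tag x) \in D1 /\ V (s' (nth d D1 (tag x))) (nth d D1 (tag x)) x.
  move=> xD; split; first exact: mem_nth.
  by move: xD; rewrite -has_find => /(nth_find d)/asboolP.
have taglc : locally_constant tag.
  have tE x : tag x = find id [seq inV x t | t <- D1].
    by rewrite find_map; apply: eq_find.
  move=> x; rewrite tE.
  have Ilc : locally_constant (fun x => [seq inV x t | t <- D1]).
    apply: lc_map => t /D1p tp.
    exact: (lc_comp (fun P : Prop => `[< P >]) (tube_lc tubesV _ tp)).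
  by apply: filterS (Ilc x) => y e; rewrite tE e.
pose A x := B x \/ tube_union D1 s' x.
have Ulc : locally_constant (tube_union D1 s').
  by apply: lc_exists_seq => t /D1p; exact: (tube_lc tubesV).
have Alc : locally_constant A.
  exact: (lc_comp (fun p => p.1 \/ p.2) (lc_pair Blc Ulc)).
have [tau [taulc tauA taumin]] :=
  hitting_time fc Alc (hits_tube_union D1per s'f hit).
(* In a tube the letter keeps only the tube index, so each tube is one class; [pi] can still be
   recovered since it is constant there. The value [size D1] of [tag] means being outside all
   tubes. *)
pose l x : nat + nat * nat :=
  if (tag x < size D1)%N then inl (tag x) else inr (pi x, q n x).
have llc : locally_constant l.
  exact: (lc_comp (fun p : nat * (nat * nat) =>
    if (p.1 < size D1)%N then inl p.1 else inr p.2)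
    (lc_pair taglc (lc_pair pilc (qlc n)))).
pose pi' x := pickle [seq l (iter j f x) | j <- iota 0 (tau x).+1].
have pi'P x y : pi' x = pi' y <-> tau x = tau y /\
    forall j, (j <= tau x)%N -> l (iter j f x) = l (iter j f y).
  split=> [/(pcan_inj pickleK) e|[txy lxy]].
    have := congr1 size e; rewrite !size_map !size_iota => -[txy].
    split=> // j jx; have := congr1 (fun u => nth (l x) u j) e.
    by rewrite !(nth_map 0%N) ?size_iota ?ltnS -?txy// !nth_iota ?ltnS.
  congr pickle; rewrite -txy; apply/eq_in_map => j.
  by rewrite mem_iota ltnS; exact: lxy.
have pi'lc : locally_constant pi'.
  move=> x; have nearl : \forall y \near x, forall j, (j < (tau x).+1)%N ->
      l (iter j f y) = l (iter j f x).
    by apply: near_all_ltn => j _; exact: (lc_iter j fc llc).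
  apply: filterS2 nearl (taulc x) => y ly ty.
  by apply/pi'P; rewrite ty; split=> // j jx; exact: ly.
have l_tag x y : l x = l y -> (tag x < size D1)%N -> tag x = tag y.
  by rewrite /l => + xD; rewrite xD; case: ifP => // _ [].
have pi'l x y : pi' x = pi' y -> l x = l y by move=> /pi'P[_ /(_ 0%N)]; exact.
have tau0 x : tube_union D1 s' x -> tau x = 0%N.
  by move=> Ux; apply/eqP; rewrite -leqn0; apply: taumin; right.
have tagV t x : t \in D1 -> V (s' t) t x -> tag x = tag t.
  move=> tD tx; apply: eq_in_find => u uD; apply/asboolP/asboolP.
    move=> ux; rewrite (tube_unique tubesV (D1p u uD) (D1p t tD) ux tx).
    exact: (tube_refl tubesV).
  move=> ut; rewrite (tube_unique tubesV (D1p u uD) (D1p t tD) ut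
    (tube_refl tubesV (s' t) t)).
  exact: tx.
exists pi', s', tau; split; first split; [exact: pi'lc|exact: s'f| |split].
- move=> t x tD tx; have tt := tube_refl tubesV (s' t) t.
  have Ux : tube_union D1 s' x by exists t.
  have Ut : tube_union D1 s' t by exists t.
  apply/pi'P; rewrite !tau0//; split=> // j; rewrite leqn0 => /eqP -> /=.
  by rewrite /l !tagE (asboolT Ux) (asboolT Ut) (tagV t x).
- exact: taulc.
- move=> x y /[dup] /pi'P[-> _] /pi'l lxy; split=> //.
  have [xD|xD] := boolP (tag x < size D1)%N; last first.
    move: lxy; rewrite /l (negPf xD).
    by case: ifP => // _ [].
  have txy := l_tag _ _ lxy xD.
  have [uD ux] := tag_nth x x xD; rewrite (s'pi _ _ uD ux).
  have yD : (tag y < size D1)%N by rewrite -txy.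
  have [_] := tag_nth y x yD; rewrite -txy => uy.
  by rewrite (s'pi _ _ uD uy).
- by move=> t tD; rewrite /s' tD.
- move=> t x y tD tx /pi'l lxy.
  have xD : (tag x < size D1)%N by rewrite tagE; apply/asboolP; exists t.
  have txy := l_tag _ _ lxy xD.
  have [uD ux] := tag_nth x x xD.
  have yD : (tag y < size D1)%N by rewrite -txy.
  have [_] := tag_nth y x yD; rewrite -txy.
  by rewrite -(tube_unique tubesV (D1p t tD) (D1p _ uD) tx ux).
move=> x nUx; have xD : (tag x < size D1)%N = false.
  by rewrite tagE; apply/asboolP.
split=> [y /pi'l|nBx].
  by rewrite /l xD; case: ifP => // _ [].
have tauS z : (0 < tau z)%N -> tau z = (tau (f z)).+1.
  move=> z0; have nAz : ~ A z by move=> /(taumin z 0%N); rewrite leqNgt z0.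
  apply/eqP; rewrite eqn_leq; apply/andP; split.
    by apply: taumin; rewrite iterSr; exact: tauA.
  rewrite -(prednK z0) ltnS; apply: taumin.
  by rewrite -iterSr prednK//; exact: tauA.
have x0 : (0 < tau x)%N.
  by rewrite lt0n; apply/eqP => e; have := tauA x; rewrite e => -[].
split; first by rewrite [X in (_ < X)%N]tauS.
move=> y /pi'P[txy lxy]; apply/pi'P.
have y0 : (0 < tau y)%N by rewrite -txy.
split; first by apply/succn_inj; rewrite -!tauS.
by move=> j jx; rewrite -!iterSr; apply: lxy; rewrite tauS.
Qed.

(** Points are separated because either [x] leaves the tubes at infinitely many levels, where [q n]
    is recorded, or it stays in ever deeper tubes of one periodic point and equals it. Contraction
    comes from [tube_step] in the tubes and from the rank elsewhere. *)
Lemma exists_partitions (D : nat -> seq X) (B : nat -> set X) :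
  (forall n, periodic_family f (D n)) -> (forall n, {subset D n <= D n.+1}) ->
  (forall n, locally_constant (B n)) ->
  (forall m n x, B m x -> B n x -> m = n) ->
  (forall n, hits f (B n) (in_tubes V (D n))) ->
  exists (pi h : nat -> X -> nat), [/\
    forall n, locally_constant (pi n) /\ locally_constant (h n),
    forall n x y, pi n.+1 x = pi n.+1 y -> pi n x = pi n y,
    forall x y, pi 0%N x = pi 0%N y,
    forall x y, (forall n, pi n x = pi n y) -> x = y &
    forall x, exists n0, forall n, (n0 <= n)%N -> forall y, pi n x = pi n y ->
      pi n.+1 (f x) = pi n.+1 (f y) \/
      (pi n (f x) = pi n (f y) /\ (h n (f x) < h n x)%N)] /\
    forall n x y, pi n x = pi n y -> h n x = h n y.
Proof.
move=> Dper Dmono Blc Bdisj hit.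
(* The periodic points whose tubes the [n]-th partition already respects; none at the start. *)
pose D0 n := if n is m.+1 then D m else [::].
have D0per n : periodic_family f (D0 n) by case: n => [|n]; [split|exact: Dper].
have D0D n : {subset D0 n <= D n} by case: n => [//|n]; exact: Dmono.
have /choice[F FP] : forall nS : nat * ((X -> nat) * (X -> nat)),
    exists S : (X -> nat) * (X -> nat) * (X -> nat),
    tube_partition (D0 nS.1) nS.2.1 nS.2.2 ->
    tube_partition (D nS.1) S.1.1 S.1.2 /\
    partition_step nS.1 (B nS.1) (D0 nS.1) (D nS.1) nS.2.1 nS.2.2
      S.1.1 S.1.2 S.2.
  move=> [n [pi s]]; have [inv|ninv] := pselect (tube_partition (D0 n) pi s).
    have [pi' [s' [h P]]] := exists_partition_step n (D0per n) (Dper n)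
      (@D0D n) (Blc n) (hit n) inv.
    by exists ((pi', s'), h).
  by exists ((pi, s), pi) => /ninv.
pose S := fix S n := if n is m.+1 then (F (m, S m)).1
  else (fun=> 0%N, fun=> 0%N).
pose h n := if n is m.+1 then (F (m, S m)).2 else fun=> 0%N.
have Sinv n : tube_partition (D0 n) (S n).1 (S n).2.
  elim: n => [|n IHn]; last by have [] := FP (n, S n) IHn.
  by split=> //; exact: lc_cst.
have Sstep n : partition_step n (B n) (D0 n) (D n) (S n).1 (S n).2
  (S n.+1).1 (S n.+1).2 (h n.+1) by have [] := FP (n, S n) (Sinv n).
pose pi n := (S n).1.
have pi_nest n x y : pi n.+1 x = pi n.+1 y -> pi n x = pi n y.
  by have [_ + _ _ _] := Sstep n => /[apply] -[].
have s_grow t n k : t \in D n -> (k <= (S (n + k).+1).2 t)%N.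
  move=> tD; elim: k => // k IHk; rewrite addnS.
  have [_ _ -> //] := Sstep (n + k).+1.
  by rewrite /D0; elim: (k) => [|i IHi]; rewrite ?addn0// addnS; exact: Dmono.
have [qlc qn qb] := qscale.
exists pi, h; split; last first.
  case=> // n x y; have [_ + _ _ _] := Sstep n => /[apply] -[] //.
split=> //.
- move=> n; split; first by have [] := Sinv n.
  by case: n => [|n]; [exact: lc_cst|have [] := Sstep n].
- move=> x y xy; have [[n0 inU]|often] := pselect (exists n0, forall n,
      (n0 <= n)%N -> tube_union (D n) (S n.+1).2 x); last first.
    apply: (scale_separates qscale) => a.
    have [n an nU] : exists2 n, (a <= n)%N & ~ tube_union (D n) (S n.+1).2 x.
      apply: contrapT => /forall2NP non; apply: often; exists a => n an.
      by have [//|/contrapT] := non n.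
    have [_ _ _ _ /(_ x nU)[/(_ y (xy _)) qxy _]] := Sstep n.
    exact: qn an qxy.
  have [t tD tx] := inU n0 (leqnn _).
  have Vt n z : (n0 <= n)%N -> pi n.+1 x = pi n.+1 z -> V ((S n.+1).2 t) t z.
    move=> n0n xz; have [u uD ux] := inU n n0n.
    have [Dp0 _] := Dper n0; have [Dpn _] := Dper n.
    have ut := tube_unique tubesV (Dpn u uD) (Dp0 t tD) ux tx.
    rewrite ut in uD ux.
    have [_ _ _ /(_ t x z uD ux xz) //] := Sstep n.
  have eqt z : (forall n, pi n x = pi n z) -> z = t.
    move=> xz; apply: (scale_separates qscale) => a.
    have [m mP] := tube_scale tubesV a t; apply: mP.
    apply: (tube_mono tubesV (s_grow t n0 m tD)).
    by apply: Vt => //; exact: leq_addr.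
  by rewrite (eqt y xy); exact: eqt.
- move=> x; have [n0 n0P] : exists n0, forall n, (n0 <= n)%N -> ~ B n x.
    have [[m Bm]|/forallNP nB] := pselect (exists m, B m x); last by exists 0%N.
    by exists m.+1 => n mn /(Bdisj _ _ _ Bm) e; rewrite e ltnn in mn.
  (* Partition [n + 1] is built with the marker [B n], hence the shift. *)
  exists n0.+1; case=> // n n0n y xy.
  have [[t tD tx]|nU] := pselect (tube_union (D n) (S n.+1).2 x); last first.
    have [_ _ _ _ /(_ x nU)[_ /(_ (n0P n n0n))[hx /(_ y xy)]]] := Sstep n.
    by right.
  left; have [_ _ _ /(_ t x y tD tx xy) ty _] := Sstep n.
  have [_ sf _] := Sinv n.+1; have [Dp Df] := Dper n.
  have [_ _ sS _ _] := Sstep n.+1.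
  have [_ _ piV] := Sinv n.+2.
  have ftD : f t \in D n.+1 by exact/Dmono/Df.
  have sft : (S n.+2).2 (f t) = ((S n.+1).2 t).+1.
    by rewrite sS ?sf//; exact: Df.
  have Vf z : V ((S n.+1).2 t) t z -> pi n.+2 (f z) = pi n.+2 (f t).
    move=> tz; apply: piV => //; rewrite sft.
    exact: (tube_step tubesV (Dp t tD) tz).
  by rewrite !Vf.
Qed.

End Partitions.

(** * Weighted sums of partition labels *)

Section WeightedSum.
Variables (R : realType) (X : topologicalType).
Variables (pi : nat -> X -> nat) (r : nat -> X -> R) (t M : nat -> R).
Hypothesis pi_nest : forall n x y, pi n.+1 x = pi n.+1 y -> pi n x = pi n y.
Hypothesis pi_ub : forall n x, (pi n.+1 x)%:R <= M n.
Hypothesis r_pi : forall n x y, pi n x = pi n y -> r n x = r n y.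
Hypothesis r_gt0 : forall n x, 0 < r n x.
Hypothesis t_ge0 : forall n, 0 <= t n.
Hypothesis tS : forall n x, r n x * M n + t n.+1 <= t n.
Hypothesis t_r : forall n x, t n.+1 <= 2^-1 ^+ n.+1 * r n x.

Let S n x : R := \sum_(k < n) r k x * (pi k.+1 x)%:R.

(** The partial sums are nondecreasing and bounded, so the supremum is the sum of the series; [t n]
    bounds its tail from index [n]. *)
Definition weighted_sum x : R := sup (range (S ^~ x)).
Local Notation psi := weighted_sum.

Let Sn n x : S n.+1 x = S n x + r n x * (pi n.+1 x)%:R.
Proof. by rewrite /S big_ord_recr. Qed.

Let S_mono m n x : (m <= n)%N -> S m x <= S n x.
Proof.
move=> mn; rewrite -(subnKC mn); elim: (n - m)%N => [|k IHk].
  by rewrite addn0.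
by rewrite addnS Sn (le_trans IHk)// lerDl mulr_ge0// ltW.
Qed.

Let S_ub n k x : S (n + k) x + t (n + k) <= S n x + t n.
Proof.
elim: k => [|k IHk]; first by rewrite addn0.
apply: le_trans IHk; rewrite addnS Sn -addrA lerD2l.
by apply: le_trans (tS _ x); rewrite lerD2r ler_wpM2l// ltW.
Qed.

Let S_le_bound n m x : S m x <= S n x + t n.
Proof.
apply: (le_trans (S_mono x (leq_maxr n m))).
have := S_ub n (maxn n m - n) x; rewrite subnKC ?leq_maxl//.
by have := t_ge0 (maxn n m); lra.
Qed.

Lemma weighted_sum_itv n x : S n x <= psi x <= S n x + t n.
Proof.
apply/andP; split.
  apply: ub_le_sup; last by exists n.
  by exists (S n x + t n) => _ [m _ <-]; exact: S_le_bound.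
apply: ge_sup; first by exists (S n x); exists n.
by move=> _ [m _ <-]; exact: S_le_bound.
Qed.

Lemma pi_nested m n x y : (m <= n)%N -> pi n x = pi n y -> pi m x = pi m y.
Proof.
move=> mn; rewrite -(subnKC mn); elim: (n - m)%N => [|k IHk]; rewrite ?addn0//.
by rewrite addnS => /pi_nest.
Qed.

Let S_pi n x y : pi n x = pi n y -> S n x = S n y.
Proof.
move=> xy; apply: eq_bigr => -[k kn] _ /=.
by rewrite (r_pi (pi_nested (ltnW kn) xy)) (pi_nested kn xy).
Qed.

Lemma weighted_sum_close n x y : pi n x = pi n y -> `|psi x - psi y| <= t n.
Proof.
move=> /S_pi xy; have := weighted_sum_itv n x; have := weighted_sum_itv n y.
by rewrite xy ler_norml; lra.
Qed.

(** Terms before the [n]-th cancel, the [n]-th ones differ by at most [M n * r n x], and the tail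
    adds at most [r n x]. *)
Lemma weighted_sum_upper n x y : pi n x = pi n y ->
  `|psi x - psi y| <= (M n + 1) * r n x.
Proof.
move=> xy; have := weighted_sum_itv n.+1 x; have := weighted_sum_itv n.+1 y.
rewrite !Sn (S_pi xy) -(r_pi xy).
have h1 := ler_wpM2l (ltW (r_gt0 n x)) (pi_ub n x).
have h2 := ler_wpM2l (ltW (r_gt0 n x)) (pi_ub n y).
have h3 : t n.+1 <= r n x.
  apply: le_trans (t_r n x) _; rewrite ler_piMl ?(ltW (r_gt0 n x))//.
  by rewrite exprn_ile1//; lra.
have h4 : 0 <= r n x * (pi n.+1 x)%:R by rewrite mulr_ge0// ltW.
have h5 : 0 <= r n x * (pi n.+1 y)%:R by rewrite mulr_ge0// ltW.
by rewrite mulrDl mul1r ler_norml (mulrC (M n)); lra.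
Qed.

(** Distinct labels separate the [n]-th terms by at least [r n x], and the tail undoes at most half
    of this. *)
Lemma weighted_sum_lower n x y : pi n x = pi n y -> pi n.+1 x <> pi n.+1 y ->
  r n x / 2 <= `|psi x - psi y|.
Proof.
wlog xy1 : x y / (pi n.+1 x < pi n.+1 y)%N => [hwlog xy xyn|xy _].
  have [xy1|yx1|//] := ltngtP (pi n.+1 x) (pi n.+1 y).
    exact: (hwlog x y xy1 xy xyn).
  by rewrite distrC (r_pi xy); exact: (hwlog y x yx1 (esym xy) (nesym xyn)).
have := weighted_sum_itv n.+1 x; have := weighted_sum_itv n.+1 y.
rewrite !Sn (S_pi xy) -(r_pi xy).
have h1 : (pi n.+1 x)%:R + 1 <= (pi n.+1 y)%:R :> R by rewrite natr1 ler_nat.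
have := ler_wpM2l (ltW (r_gt0 n x)) h1; rewrite mulrDr mulr1 => h2.
have h3 : t n.+1 <= 2^-1 * r n x.
  apply: le_trans (t_r n x) _; rewrite ler_wpM2r ?(ltW (r_gt0 n x))//.
  by rewrite exprS ler_piMr// exprn_ile1//; lra.
by rewrite distrC; have := ler_norm (psi y - psi x); lra.
Qed.

End WeightedSum.

(** * Choice of the weights and flatness of the resulting sum *)

Section FlatFromPartitions.
Variables (R : realType) (X : metricType R) (f : X -> X).
Hypothesis cptX : compact [set: X].

(** If [n] is the last level at which [x] and [y] agree, their images are at least [r n x / 2]
    apart. Both alternatives of the contraction hypothesis bring the images of [f x] and [f y]
    within [2^-n * r n x], and [n] tends to infinity as [y] tends to [x]. *)
Lemma partitions_flat_embedding (pi h : nat -> X -> nat) :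
  (forall n, locally_constant (pi n) /\ locally_constant (h n)) ->
  (forall n x y, pi n.+1 x = pi n.+1 y -> pi n x = pi n y) ->
  (forall x y, pi 0%N x = pi 0%N y) ->
  (forall x y, (forall n, pi n x = pi n y) -> x = y) ->
  (forall n x y, pi n x = pi n y -> h n x = h n y) ->
  (forall x, exists n0, forall n, (n0 <= n)%N -> forall y, pi n x = pi n y ->
      pi n.+1 (f x) = pi n.+1 (f y) \/
      (pi n (f x) = pi n (f y) /\ (h n (f x) < h n x)%N)) ->
  exists psi : X -> R, flat_embedding f psi.
Proof.
move=> lc nest pi0 sep hpi contr.
have /choice[M MP] : forall n, exists M, forall x, (pi n.+1 x < M)%N.
  by move=> n; apply: lc_bounded => //; have [] := lc n.+1.
have /choice[H HP] : forall n, exists H, forall x, (h n x < H)%N.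
  by move=> n; apply: lc_bounded => //; have [] := lc n.
(* Chosen so that [(M n + 1) * e n = 2^-n]: one unit of rank outweighs the factor in
   [weighted_sum_upper]. *)
pose e n : R := (2 ^+ n * ((M n)%:R + 1))^-1.
have den0 n : 0 < 2 ^+ n * ((M n)%:R + 1) :> R.
  by rewrite mulr_gt0 ?exprn_gt0// ltr_wpDl.
have e0 n : 0 < e n by rewrite invr_gt0.
have e1 n : e n <= 1.
  rewrite invf_le1// mulr_ege1 ?lerDr//.
  by rewrite exprn_ege1// ler1n.
(* [low n (Rw n)] is below all weights of level [n], and [Rw] is defined so that the next tail bound
   [t n.+1] is [2^-(n+1)] times it. *)
pose low n (Rn : R) : R := Rn * e n ^+ H n.
pose Rw := fix Rw n : R := if n is m.+1 then
  low m (Rw m) / (2 ^+ m.+2 * ((M m.+1)%:R + 1)) else 1.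
have Rw0 n : 0 < Rw n.
  elim: n => //= n IHn; apply: divr_gt0.
    by apply: mulr_gt0; [exact: IHn|exact: exprn_gt0].
  by apply: mulr_gt0; [exact: exprn_gt0|rewrite ltr_wpDl].
have en n k : 0 <= e n ^+ k <= 1.
  by rewrite exprn_ge0 ?exprn_ile1 ?(ltW (e0 n)).
(* Smaller rank means smaller weight; as [H n] exceeds all ranks, the subtraction never
   truncates. *)
pose r n x : R := Rw n * e n ^+ (H n - h n x).
pose t n : R := 2 * Rw n * ((M n)%:R + 1).
have r0 n x : 0 < r n x by rewrite mulr_gt0// exprn_gt0.
have rR n x : r n x <= Rw n.
  by rewrite ler_piMr ?(ltW (Rw0 n))//; case/andP: (en n (H n - h n x)%N).
have lowr n x : low n (Rw n) <= r n x.
  rewrite /low /r ler_wpM2l ?(ltW (Rw0 n))//.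
  by rewrite ler_wiXn2l ?(ltW (e0 n))// leq_subr.
have tSE n : t n.+1 = 2^-1 ^+ n.+1 * low n (Rw n).
  rewrite /t /= exprVn [2 ^+ n.+2]exprS.
  field.
  by rewrite expf_neq0//= lt0r_neq0// ltr_wpDl.
have t_r n x : t n.+1 <= 2^-1 ^+ n.+1 * r n x.
  by rewrite tSE ler_wpM2l// exprn_ge0.
have t0 n : 0 <= t n by rewrite !mulr_ge0 ?(ltW (Rw0 n))// addr_ge0.
have half_le1 n : 2^-1 ^+ n <= 1 :> R.
  by rewrite exprn_ile1// invf_le1 ?ler1n.
have tS n x : r n x * (M n)%:R + t n.+1 <= t n.
  have h1 : r n x * (M n)%:R <= Rw n * (M n)%:R by rewrite ler_wpM2r.
  have h2 : t n.+1 <= Rw n.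
    apply: le_trans (t_r n x) _; apply: le_trans (rR n x).
    by rewrite ler_piMl// ltW.
  have h3 : 0 <= Rw n * (M n)%:R by rewrite mulr_ge0// ltW.
  by rewrite [leRHS]/t mulrDr mulr1 -mulrA; have := Rw0 n; lra.
have rpi n x y : pi n x = pi n y -> r n x = r n y by move=> /hpi; rewrite /r => ->.
have piM n x : (pi n.+1 x)%:R <= (M n)%:R :> R by rewrite ler_nat ltnW.
pose psi := weighted_sum pi r.
have close n x y : pi n x = pi n y -> `|psi x - psi y| <= t n.
  exact: (weighted_sum_close nest piM rpi r0 t0 tS).
have upper n x y : pi n x = pi n y -> `|psi x - psi y| <= ((M n)%:R + 1) * r n x.
  exact: (weighted_sum_upper nest piM rpi r0 t0 tS t_r).
have lower n x y : pi n x = pi n y -> pi n.+1 x <> pi n.+1 y ->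
    r n x / 2 <= `|psi x - psi y|.
  exact: (weighted_sum_lower nest piM rpi r0 t0 tS t_r).
have first_diff x y : x <> y ->
    exists n, pi n x = pi n y /\ pi n.+1 x <> pi n.+1 y.
  move=> xy; have ex : exists n, pi n x != pi n y.
    apply: contrapT => /forallNP e'; apply: xy; apply: sep => n.
    by have /negP := e' n; rewrite negbK => /eqP.
  case: (ex_minnP ex) => -[|n] pin nmin; first by rewrite (pi0 x y) eqxx in pin.
  exists n; split; last exact/eqP.
  by apply/eqP; apply: contraT => /nmin; rewrite ltnn.
have small (d : R) : 0 < d -> exists n, 2^-1 ^+ n < d.
  move=> d0; exists (Num.truncn d^-1).
  rewrite exprVn invf_plt ?posrE ?exprn_gt0//.
  apply: lt_le_trans (truncnS_gt _) _.
  by rewrite -natrX ler_nat ltn_expl.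
have Rw_le1 n : Rw n <= 1.
  elim: n => // n IHn; have := tSE n; rewrite /t => tE.
  have h1 : low n (Rw n) <= Rw n.
    by rewrite ler_piMr ?(ltW (Rw0 n))//; case/andP: (en n (H n)).
  have h2 : 2^-1 ^+ n.+1 * low n (Rw n) <= low n (Rw n).
    by rewrite ler_piMl// mulr_ge0 ?exprn_ge0// ltW.
  have h3 : Rw n.+1 <= Rw n.+1 * ((M n.+1)%:R + 1).
    by rewrite ler_peMr ?(ltW (Rw0 _))// lerDr.
  by have := Rw0 n.+1; lra.
exists psi; split.
- move=> x; apply/cvgrPdist_lt => d d0; have [n nd] := small d d0.
  have [pilc _] := lc n.+1; apply: filterS (pilc x) => y yx.
  apply: le_lt_trans (close n.+1 _ _ (esym yx)) _.
  apply: le_lt_trans (t_r n x) _; apply: le_lt_trans nd.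
  rewrite exprS mulrAC -[leRHS]mul1r ler_wpM2r ?exprn_ge0//.
  by have := rR n x; have := Rw_le1 n; lra.
- move=> x y xy; apply: contrapT => /first_diff[n [xyn xyn1]].
  have := lower n x y xyn xyn1; rewrite xy subrr normr0.
  by have := r0 n x; lra.
- move=> x d d0; have [n0 n0P] := contr x.
  have [m md] : exists m, 2^-1 ^+ m < d / 2 by apply: small; rewrite divr_gt0.
  have [pilc _] := lc (maxn n0 m); apply: filterS (pilc x) => y yx.
  have [->|xy] := pselect (x = y); first by rewrite !subrr normr0 mulr0.
  have [n [xyn xyn1]] := first_diff x y xy.
  have nmax : (maxn n0 m <= n)%N.
    rewrite leqNgt; apply/negP => nlt; apply: xyn1.
    exact: (pi_nested nest nlt (esym yx)).
  have fbound : `|psi (f x) - psi (f y)| <= 2^-1 ^+ n * r n x.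
    have n0n : (n0 <= n)%N by rewrite (leq_trans (leq_maxl _ _) nmax).
    have [/close fxy|[/upper fxy hlt]] := n0P n n0n y xyn.
      apply: le_trans fxy _; apply: le_trans (t_r n x) _.
      rewrite ler_wpM2r ?(ltW (r0 n x))// exprS ler_piMl ?exprn_ge0//.
      lra.
    apply: le_trans fxy _.
    have re : r n (f x) <= e n * r n x.
      rewrite /r mulrCA ler_wpM2l ?(ltW (Rw0 n))// -exprS.
      by rewrite ler_wiXn2l ?(ltW (e0 n))//; have := HP n x; lia.
    have MD : 0 <= (M n)%:R + 1 :> R by rewrite addr_ge0.
    apply: le_trans (ler_wpM2l MD re) _.
    rewrite mulrA ler_wpM2r ?(ltW (r0 n x))// /e exprVn invfM mulrCA.
    by rewrite divff ?mulr1// lt0r_neq0// ltr_wpDl.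
  have xyl := lower n x y xyn xyn1.
  have nm : 2^-1 ^+ n <= 2^-1 ^+ m :> R.
    rewrite ler_wiXn2l//; [lra|].
    by rewrite (leq_trans (leq_maxr _ _) nmax).
  rewrite distrC (distrC (psi y)); apply: le_trans fbound _.
  apply: (@le_trans _ _ (d * (r n x / 2))); last by rewrite ler_wpM2l// ltW.
  have -> : d * (r n x / 2) = d / 2 * r n x by ring.
  by rewrite ler_wpM2r ?(ltW (r0 n x))//; lra.
Qed.

End FlatFromPartitions.

Theorem theorem1p2 (R : realType) (X : metricType R) (f : X -> X)
    (hX : cantor_set X) (hf : continuous f) :
  embeddable_with_vanishing_derivative f <->
  (forall p : set X, finite_orbit f p -> attracting f p).
Proof.
have [_ cptX bX _] := hX; split=> [/embeddable_flat_embedding[psi flat] p|attr].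
  exact: flat_embedding_attracting flat.
have [q qscale] := exists_clopen_scale cptX bX.
have [V tubesV] := attracting_tubes cptX hf qscale attr.
have [D [B [Dper Dmono Blc Bdisj hit]]] :=
  exists_markers cptX bX hf qscale tubesV.
have [pi [h [[lc nest pi0 sep contr] hpi]]] :=
  exists_partitions hf qscale tubesV Dper Dmono Blc Bdisj hit.
have [psi flat] := partitions_flat_embedding cptX lc nest pi0 sep hpi contr.
exact: flat_embedding_embeddable flat.
Qed.
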